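(* Let $(G,\mathcal M)$ be a tensor network on $n$ vertices (with no open legs). Then $(G,\mathcal M)$ can be contracted in time $n\,2^{\mathrm{vertcon}(G)+1}$ and space $n\,2^{\mathrm{vertcon}(G)+1}$, or in time $n\,2^{1.5\,\mathrm{edgecon}(G)+1}$ and space $n\,2^{\mathrm{edgecon}(G)+1}$. More precisely, the tensor network can be contracted in time $$\min_{(T,b)} \sum_{t\in V(T)} 2^{\mathrm{con}(t)},$$ where the minimum is over contraction trees $(T,b)$ of $G$; and the contraction can be done using space equal to the minimum, over rooted contraction trees $(T,b)$ of $G$, of the weighted directed modified cutwidth of $T$ (with edges directed towards the root) using edge weights $w(f)=2^{\mathrm{con}(f)}$ for $f\in E(T)$. If the contraction is done as a series of matrix multiplications (pairwise tensor contractions under the cost model below), these precise time and space bounds are tight, i.e., no such procedure uses less time than the stated time bound and no such procedure uses less space than the stated space bound (though the two bounds are not necessarily simultaneously achievable).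
   Context: A tensor network $(G,\mathcal M)$ consists of a finite undirected graph $G$ with positive integer edge weights $w$ and, for each vertex $v$, a complex tensor $\mathbf M_v$ with one index per incident edge, the index for edge $e$ ranging over $[2^{w(e)}]$; thus $\mathbf M_v$ has $2^{\deg(v)}$ entries, where $\deg(v)=\sum_{u} w(\{u,v\})$ is the weighted degree. Every edge joins two tensors (no open legs). Contracting two tensors (original or produced by earlier contractions) sums over all their shared indices and yields a single tensor carrying the remaining indices of both; edges of the merged vertex to any other vertex get weight equal to the sum of the corresponding weights. Full contraction is $n-1$ such pairwise contractions, yielding a number. Cost model: a tensor whose indices have total weight $s$ occupies $2^s$ units of memory. Contracting a tensor with index groups of dimensions $(d_L,d_M)$ with one of dimensions $(d_M,d_R)$ along the shared dimension $d_M$ (a matrix multiplication) takes time $d_L d_M d_R$; during the contraction memory is allocated simultaneously for both input tensors and the output tensor, after which the inputs are freed; the memory in use at any moment is the total size of all tensors held. Reading an initial tensor costs time equal to its size. A (unrooted) contraction tree $(T,b)$ of $G$ is a tree $T$ in which every vertex has degree $1$ or $3$, together with a bijection $b$ from $V(G)$ to the leaves of $T$. A rooted contraction tree is a tree $T$ with a designated leaf $r$ (the root), all other vertices of degree $1$ or $3$, with a bijection $b$ from $V(G)$ to the non-root leaves; each internal vertex represents the contraction of the two tensors produced by the subtrees below it, so sequential contraction orders correspond to orderings of $V(T)$ consistent with the tree (children before parents). For an edge $\{u,v\}\in E(G)$, its routing is the unique path in $T$ between $b(u)$ and $b(v)$. The congestion $\mathrm{con}(t)$ of a vertex $t\in V(T)$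 (resp. $\mathrm{con}(f)$ of an edge $f\in E(T)$) is the total weight of edges of $G$ whose routings contain $t$ (resp. $f$). $\mathrm{vertcon}(G)$ (resp. $\mathrm{edgecon}(G)$) is the minimum over contraction trees of $\max_{t\in V(T)}\mathrm{con}(t)$ (resp. $\max_{f\in E(T)}\mathrm{con}(f)$). Weighted directed modified cutwidth of a rooted tree $T$ with edge weights $w$ and edges directed towards the root: over linear orderings $\pi:V(T)\to[|V(T)|]$ in which for each edge the endpoint farther from the root precedes the endpoint nearer to the root, take the maximum over positions $i$ of the total weight of edges $\{u,v\}$ with $\pi(u)<i<\pi(v)$; the directed modified cutwidth is the minimum of this quantity over all such orderings.
   Formalization: For n≥2: the sum of 2^con(t) is the optimal time before the last contraction; the full optimum minimizes this sum plus 2^con(f) over trees and edges f; the modified cutwidth uses π(u)≤i≤π(v), as the strict version omits the operands and output. The literal formulas fail for n=2. *)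

(* Defs.v *)
From mathcomp Require Import all_boot all_order all_algebra.
From mathcomp Require Import boolp classical_sets reals exp.
From mathcomp Require Import complex.

Set Implicit Arguments.
Unset Strict Implicit.
Unset Printing Implicit Defensive.

Local Open Scope nat_scope.

Definition least (P : nat -> Prop) (m : nat) : Prop :=
  P m /\ forall k, P k -> m <= k.

(* Junk value 0 when P holds of no number. *)
Definition minimum (P : nat -> Prop) : nat := xget 0 [set m | least P m]%classic.

(* Finite simple graphs with positive integer edge weights.  Edges form a
   finite type; [ends] sends an edge to the unordered pair of its ends. *)
Record wgraph := WGraph {
  vertex : finType;
  edge : finType;
  ends : edge -> {set vertex};
  weight : edge -> nat;
  card_ends : forall e, #|ends e| = 2;
  ends_inj : injective ends;
  weight_gt0 : forall e, 0 < weight e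
}.

Section Trees.
Variables (T : finType) (adj : rel T).

Definition is_tree : Prop :=
  [/\ symmetric adj, irreflexive adj, forall x y, connect adj x y
    & forall c : seq T, uniq c -> cycle adj c -> size c <= 2].

Definition degree (t : T) : nat := #|[set u | adj t u]|.

(* x :: p is a path without repetition from x to y. *)
Definition simple_path (x y : T) (p : seq T) : bool :=
  [&& path adj x p, last x p == y & uniq (x :: p)].

(* u and v are adjacent and v is the end of this edge nearer to r. *)
Definition toward (r u v : T) : Prop :=
  adj u v /\ exists2 p, simple_path u r p & v \in p.

End Trees.

Record ctree (G : wgraph) := CTree {
  ct_node : finType;
  ct_adj : rel ct_node;
  ct_leaf : vertex G -> ct_node;
  ct_tree : is_tree ct_adj;
  ct_degree : forall t, degree ct_adj t \in [:: 1; 3];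
  ct_leaf_inj : injective ct_leaf;
  ct_leafP : forall t, (t \in codom ct_leaf) = (degree ct_adj t == 1)
}.

Record rooted_ctree (G : wgraph) := RootedCTree {
  rct_node : finType;
  rct_adj : rel rct_node;
  rct_root : rct_node;
  rct_leaf : vertex G -> rct_node;
  rct_tree : is_tree rct_adj;
  rct_degree : forall t, degree rct_adj t \in [:: 1; 3];
  rct_root_leaf : degree rct_adj rct_root = 1;
  rct_leaf_inj : injective rct_leaf;
  rct_leafP : forall t,
    (t \in codom rct_leaf) = (degree rct_adj t == 1) && (t != rct_root)
}.

Section Congestion.
Variables (G : wgraph) (T : finType) (adj : rel T) (b : vertex G -> T).

(* x :: p is the routing of the edge e of G, read from one of its two ends. *)
Definition routing (e : edge G) (x : T) (p : seq T) : Prop :=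
  exists u v, [/\ ends e = [set u; v]%SET, x = b u & simple_path adj x (b v) p].

Definition con_vertex (t : T) : nat :=
  \sum_(e : edge G | `[< exists x p, routing e x p /\ t \in x :: p >]) weight e.

(* zip (x :: p) p lists the pairs of consecutive vertices of the path x :: p. *)
Definition con_edge (s t : T) : nat :=
  \sum_(e : edge G | `[< exists x p, routing e x p /\
      ((s, t) \in zip (x :: p) p \/ (t, s) \in zip (x :: p) p) >]) weight e.

End Congestion.

Definition ct_con (G : wgraph) (C : ctree G) : ct_node C -> nat :=
  con_vertex (@ct_adj G C) (@ct_leaf G C).

Definition ct_edgecon (G : wgraph) (C : ctree G) : ct_node C -> ct_node C -> nat :=
  con_edge (@ct_adj G C) (@ct_leaf G C).

Definition rct_edgecon (G : wgraph) (C : rooted_ctree G) :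
    rct_node C -> rct_node C -> nat :=
  con_edge (@rct_adj G C) (@rct_leaf G C).

Definition vertcon (G : wgraph) : nat :=
  minimum (fun m => exists C : ctree G, m = \max_(t : ct_node C) ct_con t).

Definition edgecon (G : wgraph) : nat :=
  minimum (fun m => exists C : ctree G,
    m = \max_(f : ct_node C * ct_node C | ct_adj f.1 f.2) ct_edgecon f.1 f.2).

Definition tree_time (G : wgraph) (C : ctree G) : nat :=
  \sum_(t : ct_node C) 2 ^ ct_con t.

Section DirectedModifiedCutwidth.
Variables (T : finType) (adj : rel T) (r : T) (w : T -> T -> nat).

Definition rootward (pi : T -> 'I_#|T|) : Prop :=
  injective pi /\ forall u v, toward adj r u v -> pi u < pi v.

(* The edges at the vertex in position i are counted together with those
   passing over it: when i is a contraction they are its two operands and its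
   result, which are in memory at the same time. *)
Definition modified_cut (pi : T -> 'I_#|T|) (i : 'I_#|T|) : nat :=
  \sum_(f : T * T | `[< toward adj r f.1 f.2 >] && (pi f.1 <= i <= pi f.2))
    w f.1 f.2.

Definition directed_modified_cutwidth : nat :=
  minimum (fun m => exists pi, rootward pi /\
    m = \max_(i : 'I_#|T|) modified_cut pi i).

End DirectedModifiedCutwidth.

Definition tree_space (G : wgraph) (C : rooted_ctree G) : nat :=
  directed_modified_cutwidth (@rct_adj G C) (rct_root C)
    (fun u v : rct_node C => 2 ^ rct_edgecon u v).

Section Tensors.
Variables (R : realType) (G : wgraph).

(* The values of the indices in L; the index e ranges over 2 ^ weight e values. *)
Definition indices (L : {set edge G}) : finType :=
  {dffun forall e : {e : edge G | e \in L}, 'I_(2 ^ weight (val e))}.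

Definition entries (L : {set edge G}) := {ffun indices L -> R[i]}.

(* A tensor is a set of indices together with an array of entries. *)
Definition tensor := {L : {set edge G} & entries L}.

Definition wsum (L : {set edge G}) : nat := \sum_(e in L) weight e.

Definition tsize (A : tensor) : nat := 2 ^ wsum (tag A).

Definition agree (L L' : {set edge G}) (x : indices L) (y : indices L') : bool :=
  [forall e, forall e', (val e == val e') ==> (x e == y e' :> nat)].

(* For given x, the pairs (y, z) summed over correspond bijectively to the
   values of the shared indices. *)
Definition contract (A B : tensor) : tensor :=
  Tagged entries
    [ffun x : indices ((tag A :\: tag B) :|: (tag B :\: tag A))%SET =>
      (\sum_(y : indices (tag A))
        \sum_(z : indices (tag B) | [&& agree x y, agree x z & agree y z])
          tagged A y * tagged B z)%R].

(* d_L * d_M * d_R *)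
Definition contraction_time (A B : tensor) : nat :=
  2 ^ wsum (tag A :\: tag B)%SET * 2 ^ wsum (tag A :&: tag B)%SET
    * 2 ^ wsum (tag B :\: tag A)%SET.

Definition memory (H : seq tensor) : nat := \sum_(A <- H) tsize A.

End Tensors.

Definition incident (G : wgraph) (v : vertex G) : {set edge G} :=
  [set e | v \in ends e]%SET.

Record tnetwork (R : realType) := TNetwork {
  tgraph :> wgraph;
  tentries : forall v : vertex tgraph, entries R (incident v)
}.

Section Procedures.
Variables (R : realType) (N : tnetwork R).

Definition initial (v : vertex N) : tensor R N := Tagged (@entries R N) (tentries v).

(* [exec D H t s]: some sequence of readings and pairwise contractions, in
   which exactly the initial tensors of D have been read (once each), ends
   holding the tensors H, and takes time t with peak memory s. *)
Inductive exec : {set vertex N} -> seq (tensor R N) -> nat -> nat -> Prop :=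
| exec_start : exec finset.set0 [::] 0 0
| exec_read D H t s v :
    exec D H t s -> v \notin D ->
    exec (v |: D)%SET (initial v :: H)
      (t + tsize (initial v)) (maxn s (memory (initial v :: H)))
| exec_contract D H t s A B K :
    exec D H t s -> perm_eq H [:: A, B & K] ->
    exec D (contract A B :: K)
      (t + contraction_time A B) (maxn s (memory (contract A B :: H))).

Definition contracts_in (t s : nat) : Prop :=
  exists2 Z, tag Z = finset.set0 & exec [set: vertex N]%SET [:: Z] t s.

(* Everything has been done but the contraction of the last two tensors, which
   is a scalar product. *)
Definition reduces_to_pair_in (t s : nat) : Prop :=
  exists A B, exec [set: vertex N]%SET [:: A; B] t s.

End Procedures.

(* Main.v *)
Require Import Defs.
From mathcomp Require Import all_boot all_order all_algebra.
From mathcomp Require Import boolp classical_sets reals exp.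
From mathcomp Require Import complex fintype finset zify lra.

Set Implicit Arguments.
Unset Strict Implicit.
Unset Printing Implicit Defensive.

Import Order.TTheory GRing.Theory Num.Theory.

Local Open Scope nat_scope.

(* A procedure and a rooted contraction tree are two descriptions of the same
   object.  Processing the vertices of a tree in an order that respects the
   root, and holding one tensor for each tree edge from a processed vertex to an
   unprocessed one, the held tensor carries exactly the edges of G routed
   through that tree edge: at an unlabelled vertex of degree 3 each routing uses
   none or two of the three tree edges, so the set of edges of G routed through
   one tree edge is the symmetric difference of the sets for the other two, and
   their union is the set routed through the vertex.  Conversely, numbering the
   operations of a procedure by time and joining each one to the contraction
   that uses up its result gives a tree, in which time is the order required for
   the cutwidth.  For the time bounds an unrooted tree is rooted at one end x of
   the edge chosen for the final scalar product, and x is processed after all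
   the other vertices.  The coarse bounds count the 2n - 2 vertices of the tree
   and use that twice the congestion of an inner vertex is the sum of those of
   its three edges. *)

(** * Trees *)

Section TreePaths.
Variables (T : finType) (adj : rel T).
Hypothesis treeT : is_tree adj.

Let adj_sym : symmetric adj. Proof. by case: treeT. Qed.
Let adj_irr : irreflexive adj. Proof. by case: treeT. Qed.

Lemma adj_neq x y : adj x y -> x != y.
Proof. by move=> xy; apply: contraTneq xy => ->; rewrite adj_irr. Qed.

(** Shortening the walk to a simple path and closing it up through [x] gives a cycle with at least
    three vertices, unless the path is trivial. *)
Lemma tree_neighbour_unique x a c p :
  adj x a -> adj x c -> path adj a p -> last a p = c -> x \notin a :: p ->
  a = c.
Proof.
move=> xa xc pa lc; case/shortenP: pa lc => q pq uq sub lc xq.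
have cyc : cycle adj [:: x, a & q].
  by rewrite /= xa rcons_path pq lc adj_sym.
have u3 : uniq [:: x, a & q].
  rewrite cons_uniq uq andbT; apply: contra xq; rewrite !inE.
  by case/orP => [->//|/sub ->]; rewrite orbT.
have [_ _ _ /(_ _ u3 cyc)] := treeT.
by case: q lc {pq uq sub xq cyc u3} => // <-.
Qed.

Lemma path_rev x p : path adj x p -> path adj (last x p) (rev (belast x p)).
Proof.
by rewrite rev_path => H; rewrite (@eq_path _ _ adj) // => u v; rewrite adj_sym.
Qed.

Lemma last_rev_belast (x : T) p : last (last x p) (rev (belast x p)) = x.
Proof. by case: p => //= a p; rewrite rev_cons last_rcons. Qed.

Lemma rev_cons_belast (x : T) p :
  last x p :: rev (belast x p) = rev (x :: p).
Proof. by rewrite -rev_rcons -lastI. Qed.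

Lemma simple_path_rev x y p :
  simple_path adj x y p -> simple_path adj y x (rev (belast x p)).
Proof.
move=> /and3P[pp /eqP <- up]; apply/and3P; split.
- exact: path_rev.
- by rewrite last_rev_belast.
- by rewrite rev_cons_belast rev_uniq.
Qed.

Lemma simple_path_exists x y : exists p, simple_path adj x y p.
Proof.
have [_ _ /(_ x y)/connectP[p pp ->] _] := treeT.
by case/shortenP: pp => q pq uq _; exists q; rewrite /simple_path pq eqxx.
Qed.

Lemma simple_path_nil x p : simple_path adj x x p -> p = [::].
Proof.
case: p => // a p /and3P[_ /eqP /= la]; rewrite -{1}la /=.
by rewrite mem_last.
Qed.

(** If the first steps [a] and [b] differed, following one path to [y] and returning along the other
    would join two neighbours of [x] by a walk avoiding [x]. *)
Lemma simple_path_uniq x y p q :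
  simple_path adj x y p -> simple_path adj x y q -> p = q.
Proof.
elim: p x q => [|a p IH] x q.
  by move=> /and3P[_ /eqP /= -> _] /simple_path_nil ->.
case: q => [|b q].
  by move=> + /and3P[_ /eqP /= e _]; rewrite -{}e => /simple_path_nil.
move=> Hp Hq.
have [/= /andP[xa pa] /eqP la /andP[xp up]] := and3P Hp.
have [/= /andP[xb qb] /eqP lb /andP[xq uq]] := and3P Hq.
have ab : a = b.
  apply: (@tree_neighbour_unique x a b (p ++ rev (belast b q))) => //.
  - by rewrite cat_path pa la -lb path_rev.
  - by rewrite last_cat la -lb last_rev_belast.
  - move: xp xq; rewrite -!cat_cons mem_cat !inE !negb_or.
    case/andP=> -> -> /andP[xb' xq'] /=; rewrite mem_rev.
    apply/negP=> /mem_belast; rewrite inE.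
    by rewrite (negPf xb') (negPf xq').
subst b; congr cons; apply: (IH a).
- by rewrite /simple_path pa /= la eqxx.
- by rewrite /simple_path qb /= lb eqxx.
Qed.

(** [toward] only asks that [v] lie somewhere on the path to [r]. Since [v] is adjacent to [u],
    meeting it later than in the first step would close a cycle. *)
Lemma toward_head r u v p :
  toward adj r u v -> simple_path adj u r p -> p = v :: behead p.
Proof.
case=> uv [q Hq vq] Hp; rewrite -{p Hp}(simple_path_uniq Hq Hp).
case: q Hq vq => // a q /= /and3P[/= /andP[ua pa] la /andP[uq _]] vq.
congr cons; case/splitPl: vq pa uq {la} => p1 p2 l1.
rewrite cat_path => /andP[pp _]; rewrite -cat_cons mem_cat negb_or => /andP[up _].
exact: (tree_neighbour_unique ua uv pp l1 up).
Qed.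

Lemma toward_unique r u v w : toward adj r u v -> toward adj r u w -> v = w.
Proof.
have [p Hp] := simple_path_exists u r.
by move=> /toward_head/(_ Hp) ep /toward_head/(_ Hp); rewrite ep => -[].
Qed.

Lemma toward_root r v : ~ toward adj r r v.
Proof. by case=> _ [p /simple_path_nil ->]. Qed.

Lemma toward_exists r u : u != r -> exists v, toward adj r u v.
Proof.
move=> ur; have [p Hp] := simple_path_exists u r.
case: p Hp => [/and3P[_ /= e]|v p Hp]; first by rewrite (negPf ur) in e.
exists v; split; last by exists (v :: p); rewrite ?mem_head.
by case/and3P: Hp => /andP[].
Qed.

Lemma adj_toward r u v : adj u v -> toward adj r u v \/ toward adj r v u.
Proof.
move=> uv; have [p Hp] := simple_path_exists u r.
case: (boolP (v \in p)) => [vp|vp]; first by left; split => //; exists p.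
right; split; first by rewrite adj_sym.
exists (u :: p); last by rewrite mem_head.
have [pp lp up] := and3P Hp.
rewrite /simple_path /= adj_sym uv pp lp -/(uniq (u :: p)) up.
by rewrite inE eq_sym negb_or (adj_neq uv) vp.
Qed.

(** From here on paths to the root give way to a parent function; [dep] is the distance to [r]. The
    value of [par] at [r] is left unspecified, hence the guards [u != r]. *)
Lemma tree_parent r : exists (par : T -> T) (dep : T -> nat),
  [/\ forall u v, toward adj r u v <-> u != r /\ v = par u,
      forall u v, adj u v = (u != r) && (par u == v) || (v != r) && (par v == u)
    & forall u, u != r -> dep (par u) < dep u].
Proof.
have /choice[par Hpar] : forall u, exists v, u != r -> toward adj r u v.
  move=> u; case: (eqVneq u r) => [_|/(toward_exists)[v Hv]]; first by exists u.
  by exists v.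
have /choice[pt Hpt] : forall u, exists p, simple_path adj u r p.
  by move=> u; exact: simple_path_exists.
have towE u v : toward adj r u v <-> u != r /\ v = par u.
  split=> [uv|[ur ->]]; last exact: Hpar.
  have ur : u != r by apply/eqP=> e; subst u; exact: toward_root uv.
  by split=> //; exact: toward_unique uv (Hpar _ ur).
exists par, (fun u => size (pt u)); split=> [//|u v|u ur].
  apply/idP/orP => [uv|[]/andP[ur /eqP <-]].
  - by case: (adj_toward r uv) => /towE[-> ->]; rewrite eqxx; [left|right].
  - by case: (Hpar _ ur).
  - by rewrite adj_sym; case: (Hpar _ ur).
move: (toward_head (Hpar _ ur) (Hpt u)) (Hpt u).
case: (pt u) => // _ p [->] /and3P[/andP[_ pp] lp /andP[_ up]] /=.
by rewrite (@simple_path_uniq (par u) r (pt (par u)) p) //; apply/and3P.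
Qed.

Lemma rootward_exists r : exists pi, rootward adj r pi.
Proof.
have [par [dep [towE _ depP]]] := tree_parent r.
(* Vertices are sorted by decreasing distance to r. *)
pose s := sort (fun u v => dep v <= dep u) (enum T).
have ms u : u \in s by rewrite mem_sort mem_enum.
have us : uniq s by rewrite sort_uniq enum_uniq.
have ss : size s = #|T| by rewrite size_sort cardE.
have lts u : index u s < #|T| by rewrite -ss index_mem.
exists (fun u => Ordinal (lts u)); split=> [u v [] /(congr1 (nth u s))|u v].
  by rewrite !nth_index.
move=> /towE[/depP + ->] /=; rewrite ltnNge; apply: contraNT; rewrite -leqNgt.
have tr : transitive (fun u v => dep v <= dep u).
  by move=> x y z /[swap]; exact: leq_trans.
apply: (sorted_leq_index tr) => //.
by apply: sort_sorted => x y; exact: leq_total.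
Qed.

End TreePaths.

(** * Trees given by a parent function with a rank increasing towards the root *)

Section ParentFunction.
Variables (T : finType) (adj : rel T) (r : T) (par : T -> T) (rk : T -> nat).
Hypothesis adjE : forall u v,
  adj u v = (u != r) && (par u == v) || (v != r) && (par v == u).
Hypothesis rkP : forall u, u != r -> rk u < rk (par u).

(** Induction from the root outwards; the measure is the gap between the rank and the largest rank,
    which shrinks on passing to the parent. *)
Lemma parent_rank_ind (P : T -> Prop) :
  P r -> (forall u, u != r -> P (par u) -> P u) -> forall u, P u.
Proof.
move=> Pr IH u; have [m] := ubnP (\max_w rk w - rk u).
elim: m u => // m IHm u lt.
case: (eqVneq u r) => [->//|ur]; apply: IH => //; apply: IHm.
have := rkP ur; have := @leq_bigmax _ rk (par u); have := @leq_bigmax _ rk u; lia.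
Qed.

Lemma rank_lt_root u : u != r -> rk u < rk r.
Proof.
elim/parent_rank_ind: u => [|u ur IH _]; first by rewrite eqxx.
case: (eqVneq (par u) r) => [<-|/IH]; first exact: rkP.
by apply: ltn_trans; exact: rkP.
Qed.

Lemma adj_rank u v : adj u v -> rk u <= rk v -> u != r /\ par u = v.
Proof.
rewrite adjE => /orP[/andP[ur /eqP <-] //|/andP[vr /eqP <-]].
by have := rkP vr; lia.
Qed.

(* A cycle of length at least 3 would have two parents at its vertex of
   smallest rank. *)
Lemma parent_tree : is_tree adj.
Proof.
have sym : symmetric adj by move=> u v; rewrite !adjE orbC.
split=> //.
- move=> u; rewrite adjE orbb; apply/negP=> /andP[/rkP + /eqP e].
  by rewrite e ltnn.
- have toroot u : connect adj u r.
    elim/parent_rank_ind: u => // u ur; apply: connect_trans.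
    by apply: connect1; rewrite adjE ur eqxx.
  move=> u v; apply: connect_trans (toroot u) _.
  by rewrite (sym_connect_sym sym).
move=> [//|x0 c0]; set c := x0 :: c0 => uc cc.
have : x0 \in c by rewrite mem_head.
case/(@arg_minnP _ x0 (mem c) rk) => x xc xmin.
have [i c' ec] := rot_to xc.
have := cc; rewrite -(rot_cycle i) ec; have := uc; rewrite -(rot_uniq i) ec.
rewrite -(size_rot i) ec; have mc w : w \in x :: c' -> rk x <= rk w.
  by rewrite -ec mem_rot => /xmin.
case: c' mc {ec xmin xc} => [//|y [//|z c'']] mc /= /andP[_ /andP[yz _]].
rewrite rcons_path => /and3P[xy _ /andP[_]]; rewrite sym => xl.
(* Both cyclic neighbours of [x] have rank at least [rk x], so each is [par x]; but they are
   different entries of a duplicate-free list. *)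
have [_ e1] := adj_rank xy (mc y (mem_nth x (isT : 1 < size [:: x, y, z & c'']))).
have [|_ e2] := adj_rank xl; first by apply: mc; rewrite 2!in_cons mem_last !orbT.
by move: yz; rewrite -e1 e2 mem_last.
Qed.

Let treeT := parent_tree.

(** A path that does not step to the parent steps to a child, and from there it cannot climb back
    without repeating a vertex, so it only descends. *)
Lemma rank_last_down v p : v != r -> path adj v p -> par v \notin p ->
  uniq (v :: p) -> rk (last v p) <= rk v.
Proof.
elim: p v => //= a p IH v vr /andP[va pa]; rewrite inE negb_or => /andP[pva pvp].
case/andP=> vp up; move: va; rewrite adjE (negPf pva) andbF /= => /andP[ar /eqP ea].
apply: leq_trans (IH a ar pa _ up) _.
  by rewrite ea; move: vp; rewrite inE negb_or => /andP[].
by rewrite -ea ltnW // rkP.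
Qed.

(** If the path from [w] to [r] started with a child of [w], it would descend for ever and miss [r],
    whose rank is the largest. *)
Lemma parent_toward u v : toward adj r u v <-> u != r /\ v = par u.
Proof.
have H w z : toward adj r w z -> w != r /\ z = par w.
  move=> wz; have [p Hp] := simple_path_exists treeT w r.
  have [ad _] := wz; have ep := toward_head treeT wz Hp.
  have wr : w != r by apply: contraPneq wz => ->; exact: toward_root.
  split=> //; move: ad; rewrite adjE wr /= => /orP[/eqP //|/andP[zr /eqP ew]].
  move: Hp; rewrite ep -ew => /and3P[/= /andP[_ pp] /eqP /= lp /andP[np up]].
  have := rank_lt_root zr; rewrite ltnNge -lp => /negP[].
  apply: rank_last_down zr pp _ up.
  by move: np; rewrite inE negb_or => /andP[].
split=> [/H//|[ur ->]]; have [w uw] := toward_exists treeT ur.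
by have [_ <-] := H _ _ uw.
Qed.

Definition children u : {set T} := [set c | (c != r) && (par c == u)].

Lemma degree_children u : degree adj u = #|children u| + (u != r).
Proof.
rewrite /degree; case: (eqVneq u r) => [->|ur].
  rewrite addn0; apply: eq_card => v; rewrite !inE adjE eqxx /=.
  by [].
rewrite addn1 -[RHS](_ : #|par u |: children u| = _).
  apply: eq_card => v; rewrite !inE adjE ur /=; congr orb; exact: eq_sym.
rewrite cardsU1 inE; case: (eqVneq (par u) r) => //= pr.
case: (eqVneq (par (par u)) u) => //= e.
by have := rkP pr; have := rkP ur; rewrite e; lia.
Qed.

End ParentFunction.

(** * Edges of G routed through a tree edge *)

Section Infix.
Variable T : eqType.

(** Infixes of length two replace the zipped pairs because they behave well under reversal and
    concatenation of paths. *)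
Lemma zip_infix (s t x : T) p :
  ((s, t) \in zip (x :: p) p) = infix [:: s; t] (x :: p).
Proof.
elim: p x => [|a p IH] x; first by rewrite /= orbF andbF.
rewrite [zip _ _]/= in_cons IH [in RHS]/= [in LHS]/=.
rewrite xpair_eqE; by rewrite ?prefix0s ?andbT.
Qed.

Lemma infix2_index (s t : T) L : uniq L -> infix [:: s; t] L ->
  [/\ s \in L, t \in L & index t L = (index s L).+1].
Proof.
move=> uL /infixP[p1 [p2 e]]; move: uL; rewrite e cat_uniq => /and3P[_ np /=].
move=> /andP[st _]; move: np; rewrite /= => /norP[sp /norP[tp _]].
rewrite !index_cat (negPf sp) (negPf tp) /= !eqxx.
move: st; rewrite inE => /norP[/negPf -> _]; rewrite addn0 addn1.
by rewrite !mem_cat !inE !eqxx !orbT.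
Qed.

(** Here [y] is the predecessor of [t] and [z] its successor. In a duplicate-free list positions
    identify entries, so no other entry is next to [t]. *)
Lemma infix2_interior (x t : T) p : uniq (x :: p) -> t \in x :: p ->
  t != x -> t != last x p ->
  exists y z, [/\ y != z, infix [:: y; t] (x :: p), infix [:: t; z] (x :: p)
    & forall t', infix [:: t; t'] (x :: p) || infix [:: t'; t] (x :: p) =
       (t' == y) || (t' == z)].
Proof.
move=> uL; rewrite inE => /predU1P[->|tp tx tl]; first by rewrite eqxx.
move: tp uL tl; case/splitPr => p1 [|z p2] uL; first by rewrite last_cat /= eqxx.
move=> _; exists (last x p1), z.
have eL : x :: p1 ++ t :: z :: p2 = belast x p1 ++ [:: last x p1, t, z & p2].
  by rewrite -[RHS]cat_rcons -lastI.
have I1 : infix [:: last x p1; t] (x :: p1 ++ [:: t, z & p2]).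
  by rewrite eL; apply/infixP; exists (belast x p1), (z :: p2).
have I2 : infix [:: t; z] (x :: p1 ++ [:: t, z & p2]).
  by apply/infixP; exists (x :: p1), p2.
split=> // [|t'].
  by move: uL; rewrite eL cat_uniq /= !inE => /and3P[_ _ /andP[/norP[_ /norP[]]]].
apply/idP/orP => [/orP[]I|[]/eqP ->]; last by rewrite I2.
- have [_ m e] := infix2_index uL I; have [_ m' e'] := infix2_index uL I2.
  by right; have := nth_index x m; rewrite e -e' (nth_index x m') => ->.
- have [m _ e] := infix2_index uL I; have [m' _ e'] := infix2_index uL I1.
  left; move: e; rewrite e' => /succn_inj e.
  by have := nth_index x m; rewrite -e (nth_index x m') => ->.
- by rewrite I1 orbT.
Qed.

End Infix.

(** * Loads of tree edges and tree vertices *)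

Section Routings.
Variables (G : wgraph) (T : finType) (adj : rel T) (b : vertex G -> T).
Hypotheses (treeT : is_tree adj) (b_inj : injective b).

(** The congestions are refined from total weights to sets of edges of [G], because these sets are
    what the index sets of tensors are compared with. *)
Definition edge_load (s t : T) : {set edge G} :=
  [set e | `[< exists x p, routing adj b e x p /\
      ((s, t) \in zip (x :: p) p \/ (t, s) \in zip (x :: p) p) >]]%SET.

Definition vertex_load (t : T) : {set edge G} :=
  [set e | `[< exists x p, routing adj b e x p /\ t \in x :: p >]]%SET.

Lemma con_edgeE s t : con_edge adj b s t = wsum (edge_load s t).
Proof. by apply: eq_bigl => e; rewrite inE. Qed.

Lemma con_vertexE t : con_vertex adj b t = wsum (vertex_load t).
Proof. by apply: eq_bigl => e; rewrite inE. Qed.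

Lemma edge_loadC s t : edge_load s t = edge_load t s.
Proof.
apply/setP => e; rewrite !inE; apply: asbool_equiv_eq.
by split=> -[x [p [rt /or_comm st]]]; exists x, p.
Qed.

Lemma ends_pair (e : edge G) : exists u v, u != v /\ ends e = [set u; v]%SET.
Proof.
by have /eqP/cards2P[u [v [uv ->]]] := card_ends e; exists u, v.
Qed.

(** Simple paths in a tree are unique, so all routings of [e] are one path and its reversal, and
    every load question about [e] can be read off this one path. *)
Lemma routing_exists (e : edge G) : exists u v p, [/\ u != v,
  ends e = [set u; v]%SET, simple_path adj (b u) (b v) p,
  forall t, (e \in vertex_load t) = (t \in b u :: p)
  & forall s t, (e \in edge_load s t) =
      infix [:: s; t] (b u :: p) || infix [:: t; s] (b u :: p)].
Proof.
have [u [v [uv ee]]] := ends_pair e.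
have [p Hp] := simple_path_exists treeT (b u) (b v).
exists u, v, p.
have rt : routing adj b e (b u) p by exists u, v.
have H x q : routing adj b e x q -> x :: q = b u :: p \/ x :: q = rev (b u :: p).
  case=> u' [v' [ee' -> Hq]].
  have : u' \in [set u; v]%SET by rewrite -ee ee' !inE eqxx.
  have : v' \in [set u; v]%SET by rewrite -ee ee' !inE eqxx orbT.
  have nuv : u' != v'.
    by have := card_ends e; rewrite ee' cards2; case: eqP.
  rewrite !inE => /orP[]/eqP e2 /orP[]/eqP e1; subst u' v'.
  - by rewrite eqxx in nuv.
  - right; have := simple_path_rev treeT Hp => /(simple_path_uniq treeT Hq) ->.
    have /and3P[_ /eqP <- _] := Hp; exact: rev_cons_belast.
  - by left; rewrite (simple_path_uniq treeT Hq Hp).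
  - by rewrite eqxx in nuv.
split=> // [t|s t]; rewrite inE.
  apply/asboolP/idP => [[x [q [/H[] ->]]]|tp]; rewrite ?mem_rev //.
  by exists (b u), p.
apply/asboolP/idP => [[x [q [/H Hq]]]|/orP st]; last first.
  by exists (b u), p; split=> //; rewrite !zip_infix.
rewrite !zip_infix => /orP.
case: Hq => -> //; rewrite -[[:: s; t]]revK -[[:: t; s]]revK !infix_rev.
by rewrite -![rev _]/[:: _; _] orbC.
Qed.

Lemma infix2_adj s t x y p : simple_path adj x y p -> infix [:: s; t] (x :: p) ->
  adj s t.
Proof.
move=> /and3P[pp _ _] /infixP[[|a p1] [p2 /= [e1 e2]]]; move: pp.
  by rewrite e2 e1 /= => /andP[].
by rewrite e2 cat_path /= => /and3P[_ _ /andP[]].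
Qed.

Lemma edge_load_interior t (e : edge G) : t \notin b @: ends e ->
  e \in vertex_load t -> exists y z, [/\ y != z, adj t y, adj t z &
    forall t', (e \in edge_load t t') = (t' == y) || (t' == z)].
Proof.
have [u [v [p [uv ee Hp -> El]]]] := routing_exists e => tb tp.
have [sym _ _ _] := treeT.
have [pp /eqP lp up] := and3P Hp.
have [||y [z [yz Iy Iz H]]] := infix2_interior up tp.
- by apply: contraNneq tb => ->; rewrite imset_f // ee !inE eqxx.
- by rewrite lp; apply: contraNneq tb => ->; rewrite imset_f // ee !inE eqxx orbT.
exists y, z; split=> // [||t'].
- by rewrite sym; exact: infix2_adj Hp Iy.
- exact: infix2_adj Hp Iz.
- by rewrite El H.
Qed.

Lemma edge_load_vertex s t : edge_load s t \subset vertex_load s.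
Proof.
apply/subsetP => e; have [u [v [p [uv ee Hp -> ->]]]] := routing_exists e.
by case/and3P: Hp => _ _ up /orP[] /(infix2_index up) [].
Qed.

Lemma endpoint_load t (e : edge G) : t \in b @: ends e -> e \in vertex_load t.
Proof.
have [u [v [p [uv ee Hp -> _]]]] := routing_exists e.
rewrite ee imsetU1 imset_set1 !inE => /orP[]/eqP ->; rewrite ?eqxx //.
by have /and3P[_ /eqP <- _] := Hp; have := mem_last (b u) p; rewrite inE.
Qed.

(** A routing that passes through [t] without ending there would need two different neighbours of
    [t]. The leaf [t] may be unlabelled, as the root of a rooted tree is; its load is then empty. *)
Lemma leaf_load t p : degree adj t = 1 -> adj t p ->
  edge_load t p = [set e | t \in b @: ends e]%SET /\ vertex_load t = edge_load t p.
Proof.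
move=> /eqP/cards1P[q eq] tp.
have N s : adj t s -> s = p.
  have nb w : adj t w = (w == q) by have := in_set1 w q; rewrite -eq inE.
  by move: tp; rewrite !nb => /eqP -> /eqP.
have V : vertex_load t = [set e | t \in b @: ends e]%SET.
  apply/setP=> e; rewrite [RHS]inE; apply/idP/idP => [te|/endpoint_load //].
  apply: contraT => tb; have [y [z [yz /N ey /N ez _]]] := edge_load_interior tb te.
  by rewrite ey ez eqxx in yz.
suff E : edge_load t p = vertex_load t by rewrite -V E.
apply/eqP; rewrite eqEsubset edge_load_vertex /=; apply/subsetP => e.
rewrite V inE; have [u [v [s [uv ee Hs _ ->]]]] := routing_exists e.
have [sym _ _ _] := treeT.
have bb : b u != b v by apply: contra uv => /eqP/b_inj ->.
rewrite ee imsetU1 imset_set1 !inE => /orP[]/eqP et; subst t.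
  case: s Hs => [/and3P[_ /= e']|a s Hs]; first by rewrite (negPf bb) in e'.
  have := Hs => /and3P[/andP[/N -> _] _ _].
  by apply/orP; left; apply/infixP; exists [::], s.
have /and3P[_ /eqP ls _] := Hs.
(* Here [t] is the far end of the routing, so its last step has to be inspected instead of its
   first. *)
elim/last_ind: s Hs ls => [_ /= e'|s a _ Hs]; first by rewrite e' eqxx in bb.
rewrite last_rcons => ea; subst a.
have I : infix [:: last (b u) s; b v] (b u :: rcons s (b v)).
  apply/infixP; exists (belast (b u) s), [::].
  by rewrite -rcons_cons lastI -!cats1 -catA.
have := infix2_adj Hs I; rewrite sym => /N <-.
by rewrite I orbT.
Qed.

(** A routing through [t] uses exactly two of the three tree edges. The symmetric difference is the
    index set produced by [contract], and the union is the one whose weight gives the contraction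
    time. *)
Lemma inner_load t p q s : t \notin codom b -> degree adj t = 3 ->
  adj t p -> adj t q -> adj t s -> uniq [:: p; q; s] ->
  edge_load t s = ((edge_load t p :\: edge_load t q) :|:
                   (edge_load t q :\: edge_load t p))%SET /\
  vertex_load t = (edge_load t p :|: edge_load t q)%SET.
Proof.
move=> tb d3 tp tq ts upqs.
have N w : adj t w -> w \in [:: p; q; s].
  have sub : {subset [:: p; q; s] <= [set u | adj t u]%SET}.
    by move=> z; rewrite !inE => /or3P[]/eqP ->.
  have := @uniq_min_size _ [:: p; q; s] (enum [set u | adj t u]%SET) upqs.
  case=> [z /sub|| _ H]; first by rewrite mem_enum.
    by rewrite -cardE -/(degree adj t) d3.
  by move=> tw; rewrite H mem_enum inE.
have te (e : edge G) : t \notin b @: ends e.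
  by apply: contra tb => /imsetP[x _ ->]; exact: codom_f.
have H (e : edge G) : if e \in vertex_load t then
    exists y z, [/\ y != z, y \in [:: p; q; s], z \in [:: p; q; s] &
    forall t', (e \in edge_load t t') = (t' == y) || (t' == z)]
  else forall t', e \notin edge_load t t'.
  case: ifPn => [/(edge_load_interior (te e))[y [z [yz ty tz E]]]|ne t'].
    by exists y, z; split=> //; exact: N.
  by apply: contra ne; exact: subsetP (edge_load_vertex _ _) _.
suff K (e : edge G) :
    (e \in edge_load t s) = (e \in edge_load t p) (+) (e \in edge_load t q) /\
    (e \in vertex_load t) = (e \in edge_load t p) || (e \in edge_load t q).
  split; apply/setP => e; rewrite in_setU ?in_setD; have [E1 E2] := K e;
    rewrite ?E1 ?E2 //.
  by do 2!case: (e \in _).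
have [pq ps qs] : [/\ p != q, p != s & q != s].
  by move: upqs; rewrite /= !inE negb_or andbT => /andP[/andP[]].
have := H e; case: ifP => [_ [y [z [yz yP zP E]]]|_ E]; last by rewrite !(negPf (E _)).
rewrite !E; move: yP zP yz; rewrite !inE => /or3P[]/eqP -> /or3P[]/eqP ->;
  rewrite ?eqxx // ?[q == p]eq_sym ?[s == p]eq_sym ?[s == q]eq_sym;
  by rewrite ?(negPf pq) ?(negPf ps) ?(negPf qs).
Qed.

End Routings.

(** * From trees to procedures *)

Section Sizes.
Variables (R : realType) (G : wgraph).
Implicit Types A B : {set edge G}.

Lemma wsum0 : @wsum G set0 = 0.
Proof. by rewrite /wsum big_set0. Qed.

Lemma wsum_sub A B : A \subset B -> wsum A <= wsum B.
Proof.
move=> sAB; rewrite /wsum [X in _ <= X](big_setID A) /=.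
by rewrite (setIidPr sAB) leq_addr.
Qed.

Lemma wsumID A B : wsum A = wsum (A :&: B) + wsum (A :\: B).
Proof. by rewrite /wsum (big_setID B). Qed.

Lemma wsumU A B :
  wsum (A :|: B) = wsum (A :\: B) + wsum (A :&: B) + wsum (B :\: A).
Proof.
rewrite (wsumID (A :|: B) B) setIUl setIid (setUidPr (subsetIr _ _)).
rewrite setDUl setDv setU0 (wsumID B A) [B :&: A]setIC; lia.
Qed.

Lemma wsum_symdiff A B :
  wsum ((A :\: B) :|: (B :\: A)) = wsum (A :\: B) + wsum (B :\: A).
Proof.
rewrite wsumU -addnA; congr (wsum _ + _).
  by apply/setP => e; rewrite !inE; do 2!case: (e \in _).
rewrite (_ : _ :&: _ = set0) ?wsum0; last first.
  by apply/setP => e; rewrite !inE; do 2!case: (e \in _).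
by congr wsum; apply/setP => e; rewrite !inE; do 2!case: (e \in _).
Qed.

(** The three exponents add up over a partition of the union of the index sets. *)
Lemma contraction_timeE (A B : tensor R G) :
  contraction_time A B = 2 ^ wsum (tag A :|: tag B).
Proof. by rewrite /contraction_time wsumU !expnD. Qed.

Lemma tag_contract (A B : tensor R G) :
  tag (contract A B) = (tag A :\: tag B) :|: (tag B :\: tag A).
Proof. by []. Qed.

Lemma memory_cons (A : tensor R G) H : memory (A :: H) = Defs.tsize A + memory H.
Proof. by rewrite /memory big_cons. Qed.

Lemma memory_perm (H K : seq (tensor R G)) : perm_eq H K -> memory H = memory K.
Proof. exact: perm_big. Qed.

Lemma memory_map (T : finType) (f : T -> tensor R G) (B : {set T}) :
  memory [seq f u | u <- enum B] = \sum_(u in B) Defs.tsize (f u).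
Proof. by rewrite /memory big_map big_enum. Qed.

End Sizes.

Lemma perm_enumU1 (T : finType) (u : T) (A : {set T}) : u \notin A ->
  perm_eq (enum (u |: A)) (u :: enum A).
Proof.
move=> uA; apply: uniq_perm; rewrite /= ?enum_uniq ?mem_enum ?uA // => w.
by rewrite inE !mem_enum !inE.
Qed.

(** * Running a tree in an order that respects its root *)

Section TreeExec.
Variables (R : realType) (N : tnetwork R).
Variables (T : finType) (adj : rel T) (b : vertex N -> T) (r : T).
Hypotheses (treeT : is_tree adj) (b_inj : injective b).
(** The conditions on degrees and labels leave out [r], so that the section covers both the
    unlabelled root of a rooted tree and an unrooted tree rooted at any of its vertices. *)
Hypothesis deg : forall t, t != r -> degree adj t \in [:: 1; 3].
Hypothesis leafP : forall t, t != r -> (t \in codom b) = (degree adj t == 1).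
Variable par : T -> T.
Hypothesis parP : forall u v, toward adj r u v <-> u != r /\ v = par u.
Hypothesis adjE : forall u v,
  adj u v = (u != r) && (par u == v) || (v != r) && (par v == u).
Variable pi : T -> 'I_#|T|.
Hypothesis pi_rootward : rootward adj r pi.
Variable M : nat.
Hypothesis cutM : forall i,
  modified_cut adj r (fun u v => 2 ^ con_edge adj b u v) pi i <= M.

Let pi_inj : injective pi. Proof. by case: pi_rootward. Qed.

Let pi_par u : u != r -> pi u < pi (par u).
Proof. by move=> ur; case: pi_rootward => _; apply; apply/parP. Qed.

Let adj_par u : u != r -> adj u (par u).
Proof. by move=> ur; rewrite adjE ur eqxx. Qed.

Let lt_root u : u != r -> pi u < pi r.
Proof. exact: (@rank_lt_root _ r par (fun u => pi u) pi_par). Qed.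

Let deg_ch u : degree adj u = #|children r par u| + (u != r).
Proof. exact: (@degree_children _ adj r par (fun u => pi u) adjE pi_par). Qed.

Let ld u := edge_load adj b u (par u).

Lemma modified_cut_par w i : modified_cut adj r w pi i =
  \sum_(u | (u != r) && (pi u <= i <= pi (par u))) w u (par u).
Proof.
rewrite /modified_cut -(pair_big_dep xpredT
  (fun u v => `[< toward adj r u v >] && (pi u <= i <= pi v)) w) /=.
rewrite (bigID (fun u => (u != r) && (pi u <= i <= pi (par u)))) /=.
rewrite [X in _ + X]big1 ?addn0 => [|u nu]; last first.
  apply: big_pred0 => v; apply: contraNF nu.
  by move=> /andP[/asboolP/parP[-> ->]].
apply: eq_bigr => u /andP[ur hu]; rewrite (big_pred1 (par u)) // => v /=.
apply/andP/eqP => [[/asboolP/parP[]]//|->].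
by split=> //; apply/asboolP/parP.
Qed.

Definition active (k : nat) : {set T} :=
  [set u | [&& u != r, pi u < k & k <= pi (par u)]].

Definition labelled_before (k : nat) : {set vertex N} := [set v | pi (b v) < k].

(** The invariant of the run. In its last clause a reading raises [k], [size H] and the number of
    labels by one, while a contraction raises [k] and lowers [size H]; at the end this counts the
    vertices of the tree. *)
Definition exec_before (k : nat) : Prop := exists H (f : T -> tensor R N) t s,
  [/\ exec (labelled_before k) H t s, perm_eq H [seq f u | u <- enum (active k)],
      {in active k, forall u, tag (f u) = ld u},
      t = \sum_(u | pi u < k) 2 ^ con_vertex adj b u
    & s <= M /\ k + size H = 2 * #|labelled_before k|].

(** The tensors present while [u] is processed correspond to the tree edges counted at position
    [pi u]: the edges below [u] are still active and the edge above [u] is added. *)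
Lemma memory_active u (f : T -> tensor R N) : u != r ->
  {in u |: active (pi u), forall w, tag (f w) = ld w} ->
  memory [seq f w | w <- enum (u |: active (pi u))] <= M.
Proof.
move=> ur tg; apply: leq_trans (cutM (pi u)).
rewrite memory_map modified_cut_par eq_leq //.
apply: eq_big => [w|w wA]; last by rewrite /Defs.tsize tg // con_edgeE.
rewrite !inE; case: (eqVneq w u) => [->|wu] /=.
  by rewrite ur leqnn ltnW // pi_par.
by rewrite [pi w <= _]leq_eqVlt val_eqE (inj_eq pi_inj) (negPf wu).
Qed.

Lemma exec_before0 : exec_before 0.
Proof.
have D0 : labelled_before 0 = set0 by apply/setP => v; rewrite !inE.
have A0 : active 0 = set0 by apply/setP => v; rewrite !inE andbF.
exists [::].
(* No vertex is active yet, so [f] can be a dummy. *)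
exists (fun _ => Tagged (@entries R N) (0%R : entries R (set0 : {set edge N}))), 0, 0.
rewrite D0 A0 cards0 enum_set0; split=> //; first exact: exec_start.
- by move=> u; rewrite inE.
- by rewrite big_pred0.
Qed.

Lemma sum_before (F : T -> nat) u :
  \sum_(w | pi w < (pi u).+1) F w = F u + \sum_(w | pi w < pi u) F w.
Proof.
rewrite (bigD1 u) ?ltnS //=; congr (_ + _); apply: eq_bigl => w.
rewrite ltnS [in LHS]leq_eqVlt val_eqE (inj_eq pi_inj).
by case: eqVneq => [->|] /=; rewrite ?ltnn ?andbT.
Qed.

(** A leaf other than the root has no children, so no held tensor is used up, and reading its label
    adds one. *)
Lemma exec_before_leaf u : u != r -> degree adj u = 1 ->
  exec_before (pi u) -> exec_before (pi u).+1.
Proof.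
move=> ur d1 [H [f [t [s [exH permH tagH tE [sM cnt]]]]]].
have /codomP[v uv] : u \in codom b by rewrite leafP // d1.
have [Lu Vu] := leaf_load treeT b_inj d1 (adj_par ur).
have Lv : edge_load adj b u (par u) = incident v.
  by rewrite Lu; apply/setP => e; rewrite !inE uv mem_imset.
have ch0 c : c != r -> par c != u.
  move=> cr; apply/negP => cu; have := deg_ch u.
  rewrite d1 ur addn1 => -[/esym/eqP]; rewrite cards_eq0 => /eqP/setP/(_ c).
  by rewrite !inE cr cu.
have uA : u \notin active (pi u) by rewrite inE ltnn andbF.
have vD : v \notin labelled_before (pi u) by rewrite inE uv ltnn.
have AE : active (pi u).+1 = u |: active (pi u).
  apply/setP => w; rewrite !inE ltnS [pi w <= _]leq_eqVlt val_eqE (inj_eq pi_inj).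
  case: (eqVneq w u) => [->|wu] /=; first by rewrite ur pi_par.
  case: (eqVneq w r) => //= wr; rewrite [pi u <= _]leq_eqVlt val_eqE eq_sym.
  by rewrite (inj_eq pi_inj) (negPf (ch0 _ wr)).
have DE : labelled_before (pi u).+1 = v |: labelled_before (pi u).
  apply/setP => w; rewrite !inE ltnS leq_eqVlt val_eqE (inj_eq pi_inj) uv.
  by rewrite (inj_eq b_inj).
pose f' w := if w == u then initial v else f w.
have f'A : {in active (pi u), f' =1 f}.
  by move=> w wA; rewrite /f'; case: eqVneq wA uA => [->->|].
have mapf' : [seq f' w | w <- enum (active (pi u))] =
    [seq f w | w <- enum (active (pi u))].
  by apply/eq_in_map => w; rewrite mem_enum => /f'A.
have permH' : perm_eq (initial v :: H) [seq f' w | w <- enum (u |: active (pi u))].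
  rewrite perm_sym (perm_trans (perm_map f' (perm_enumU1 uA))) //= {1}/f' eqxx.
  by rewrite perm_cons perm_sym mapf'.
have tagH' : {in u |: active (pi u), forall w, tag (f' w) = ld w}.
  move=> w; rewrite in_setU1 => /predU1P[->|wA]; last by rewrite f'A // tagH.
  by rewrite /f' eqxx /ld Lv.
exists (initial v :: H), f', (t + Defs.tsize (initial v)),
  (maxn s (memory (initial v :: H))); rewrite AE DE; split=> //.
- exact: exec_read.
- by rewrite sum_before -tE addnC con_vertexE Vu Lv.
- split; first by rewrite geq_max sM (memory_perm permH') memory_active.
  by rewrite cardsU1 vD mulnDr -cnt muln1 add2n addSn addnS.
Qed.

(** The parent of both children is [u], at the current position, so both are active; contracting
    their tensors gives the load of the edge above [u] by [inner_load]. *)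
Lemma exec_before_inner u : u != r -> degree adj u = 3 ->
  exec_before (pi u) -> exec_before (pi u).+1.
Proof.
move=> ur d3 [H [f [t [s [exH permH tagH tE [sM cnt]]]]]].
have ub : u \notin codom b by rewrite leafP // d3.
have := deg_ch u.
rewrite d3 ur => /eqP; rewrite addn1 eqSS eq_sym => /cards2P[c1 [c2 [c12 chE]]].
have chP c : (c != r) && (par c == u) = (c == c1) || (c == c2).
  by have := in_set2 c c1 c2; rewrite -chE inE.
have /andP[c1r /eqP p1] : (c1 != r) && (par c1 == u) by rewrite chP eqxx.
have /andP[c2r /eqP p2] : (c2 != r) && (par c2 == u) by rewrite chP eqxx orbT.
have a1 : adj u c1 by rewrite adjE c1r p1 eqxx orbT.
have a2 : adj u c2 by rewrite adjE c2r p2 eqxx orbT.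
have parN c : c != r -> par c = u -> par u != c.
  move=> cr pc; apply/eqP => e; have := pi_par ur; have := pi_par cr.
  by rewrite pc e; lia.
have u3 : uniq [:: c1; c2; par u].
  rewrite /= !inE negb_or c12 /= andbT eq_sym parN // eq_sym.
  by rewrite parN.
have [Lu Vu] := inner_load treeT ub d3 a1 a2 (adj_par ur) u3.
have l1 : ld c1 = edge_load adj b u c1 by rewrite /ld p1 edge_loadC.
have l2 : ld c2 = edge_load adj b u c2 by rewrite /ld p2 edge_loadC.
have uA : u \notin active (pi u) by rewrite inE ltnn andbF.
pose A0 := active (pi u) :\ c1 :\ c2.
have c1A : c1 \in active (pi u).
  by have := pi_par c1r; rewrite inE c1r p1 leqnn andbT.
have c2A : c2 \in active (pi u) :\ c1.
  by have := pi_par c2r; rewrite !inE eq_sym c12 c2r p2 leqnn andbT.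
have permA : perm_eq (enum (active (pi u))) [:: c1, c2 & enum A0].
  rewrite -{1}(setD1K c1A) -{1}(setD1K c2A).
  apply: perm_trans (perm_enumU1 _) _.
    by rewrite !inE !eqxx (negPf c12).
  by rewrite perm_cons perm_enumU1 // !inE eqxx.
have uA0 : u \notin A0 by rewrite !in_setD1 (negPf uA) !andbF.
have AE : active (pi u).+1 = u |: A0.
  apply/setP => w; rewrite !inE ltnS [pi w <= _]leq_eqVlt val_eqE (inj_eq pi_inj).
  case: (eqVneq w u) => [->|wu] /=; first by rewrite ur pi_par.
  have := chP w; case: (eqVneq w r) => [_|wr] /=; first by rewrite !andbF.
  rewrite [pi u <= _]leq_eqVlt val_eqE eq_sym (inj_eq pi_inj) => e.
  rewrite e; case: (eqVneq w c1) e => [->|w1] e /=.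
    by rewrite p1 ltnn !andbF.
  case: (eqVneq w c2) e => [->|w2] e //=; first by rewrite p2 ltnn !andbF.
have DE : labelled_before (pi u).+1 = labelled_before (pi u).
  apply/setP => w; rewrite !inE ltnS leq_eqVlt val_eqE (inj_eq pi_inj).
  by case: eqVneq => //= e; rewrite -e codom_f in ub.
pose C := contract (f c1) (f c2).
pose f' w := if w == u then C else f w.
have f'A : {in active (pi u), f' =1 f}.
  by move=> w wA; rewrite /f'; case: eqVneq wA uA => [->->|].
have mapf' : [seq f' w | w <- enum (active (pi u))] =
    [seq f w | w <- enum (active (pi u))].
  by apply/eq_in_map => w; rewrite mem_enum => /f'A.
have A0A : {subset A0 <= active (pi u)} by move=> w; rewrite !in_setD1 => /and3P[].
pose K := [seq f w | w <- enum A0].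
have permH2 : perm_eq H [:: f c1, f c2 & K].
  exact: perm_trans permH (perm_map f permA).
(* While the contraction takes place both operands are still in memory, hence all of [active (pi u)]
   and not only [A0]. *)
have permCH : perm_eq (C :: H) [seq f' w | w <- enum (u |: active (pi u))].
  rewrite perm_sym (perm_trans (perm_map f' (perm_enumU1 uA))) //= {1}/f' eqxx.
  by rewrite perm_cons perm_sym mapf'.
have tagC : tag C = ld u.
  rewrite tag_contract tagH // tagH; last by move: c2A; rewrite in_setD1 => /andP[].
  by rewrite l1 l2 /ld Lu.
have tagH' : {in u |: active (pi u), forall w, tag (f' w) = ld w}.
  move=> w; rewrite in_setU1 => /predU1P[->|wA]; last by rewrite f'A // tagH.
  by rewrite /f' eqxx.
exists (C :: K), f', (t + contraction_time (f c1) (f c2)), (maxn s (memory (C :: H))).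
rewrite AE DE; split=> //.
- exact: exec_contract.
- rewrite perm_sym (perm_trans (perm_map f' (perm_enumU1 uA0))) //= {1}/f' eqxx.
  rewrite perm_cons; have -> // : [seq f' w | w <- enum A0] = K.
  by apply/eq_in_map => w; rewrite mem_enum => /A0A/f'A.
- move=> w wA; apply: tagH'; move: wA; rewrite !in_setU1.
  by case/orP => [->//|/A0A ->]; rewrite orbT.
- rewrite sum_before -tE addnC con_vertexE contraction_timeE Vu.
  rewrite tagH // tagH; last by move: c2A; rewrite in_setD1 => /andP[].
  by rewrite l1 l2.
- split; first by rewrite geq_max sM (memory_perm permCH) memory_active.
  by rewrite -cnt (perm_size permH2) addSnnS.
Qed.

(** An injection into ['I_#|T|] is onto, and whatever vertex sits in the last position cannot
    precede the root. *)
Lemma pi_root : pi r = #|T|.-1 :> nat.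
Proof.
have [g piK gK] := inj_card_bij pi_inj (eq_leq (card_ord _)).
have lt : #|T|.-1 < #|T| by case: #|T| (pi r) => [[]|].
have : pi r <= #|T|.-1 by rewrite -ltnS (ltn_predK (ltn_ord (pi r))).
rewrite leq_eqVlt => /predU1P[//|H].
case: (eqVneq (g (Ordinal lt)) r) => [e|/lt_root].
  by rewrite -e gK.
by rewrite gK /= ltnNge ltnW.
Qed.

Lemma exec_before_root : exec_before (pi r).
Proof.
have [g piK gK] := inj_card_bij pi_inj (eq_leq (card_ord _)).
suff H k : k <= pi r -> exec_before k by exact: H.
elim: k => [|k IH] kr; first exact: exec_before0.
have /IH := ltnW kr; have lk := ltn_trans kr (ltn_ord _).
have ek : k = pi (g (Ordinal lk)) by rewrite gK.
rewrite {}ek in kr *; have ur : g (Ordinal lk) != r.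
  by apply: contraTneq kr => ->; rewrite ltnn.
have := deg ur; rewrite !inE => /orP[]/eqP d.
  exact: exec_before_leaf.
exact: exec_before_inner.
Qed.

(** The run stops just before the root, holding the tensors of its children, because what happens
    there differs: nothing for a rooted tree, a reading or a contraction for an unrooted one. *)
Lemma tree_exec : exists H (f : T -> tensor R N) t s,
  [/\ exec [set v | b v != r] H t s,
      perm_eq H [seq f u | u <- enum (children r par r)],
      {in children r par r, forall u, tag (f u) = edge_load adj b u r},
      t = \sum_(u | u != r) 2 ^ con_vertex adj b u
    & s <= M /\ #|T|.-1 + size H = 2 * #|[set v | b v != r]|].
Proof.
have ltE u : (pi u < pi r) = (u != r).
  apply/idP/idP => [|/lt_root //].
  by apply: contraTneq => ->; rewrite ltnn.
have [H [f [t [s []]]]] := exec_before_root.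
have -> : labelled_before (pi r) = [set v | b v != r].
  by apply/setP => v; rewrite !inE ltE.
have -> : active (pi r) = children r par r.
  apply/setP => u; rewrite !inE ltE; case: (u != r) => //=.
  by rewrite leqNgt ltE negbK.
rewrite pi_root => exH permH tagH tE cnt; exists H, f, t, s; split=> //.
- by move=> u uc; rewrite tagH //; move: uc; rewrite inE => /andP[_ /eqP <-].
- by rewrite tE; apply: eq_bigl => u; rewrite -pi_root ltE.
Qed.

End TreeExec.

(** * Minima of sets of numbers *)

Lemma minimum_least (P : nat -> Prop) : (exists m, P m) -> least P (minimum P).
Proof.
move=> [m Pm]; apply: (@xgetPex _ 0 [set m | least P m]%classic).
have ex : exists n, `[< P n >] by exists m; apply/asboolP.
exists (ex_minn ex); case: ex_minnP => k /asboolP Pk kmin.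
by split=> // n /asboolP/kmin.
Qed.

Lemma minimum_le (P : nat -> Prop) m : P m -> minimum P <= m.
Proof. by move=> Pm; have [_] := minimum_least (ex_intro _ m Pm); apply. Qed.

(** In the applications [P] holds of the costs of procedures and [Q] of the values computed from
    trees; it is enough that each side undercuts or equals the other. *)
Lemma least_minimum (P Q : nat -> Prop) : (exists m, Q m) ->
  (forall m, Q m -> exists2 m', P m' & m' <= m) ->
  (forall m, P m -> exists2 m', Q m' & m' <= m) ->
  least P (minimum Q).
Proof.
move=> exQ QP PQ; have [Qm Qmin] := minimum_least exQ.
have lb k : P k -> minimum Q <= k.
  by move=> /PQ[m /Qmin]; exact: leq_trans.
split=> //; have [m Pm le] := QP _ Qm.
by have /eqP <- : m == minimum Q by rewrite eqn_leq le lb.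
Qed.

(** [rootward_exists] makes the set of orderings nonempty, so the cutwidth is a true minimum and not
    the junk value 0. *)
Lemma directed_modified_cutwidth_attained (T : finType) (adj : rel T) r w :
  is_tree adj -> exists2 pi, rootward adj r pi &
    forall i, modified_cut adj r w pi i <= directed_modified_cutwidth adj r w.
Proof.
move=> treeT; have [pi0 Hpi0] := rootward_exists treeT r.
have [|[pi [Hpi e]] _] := @minimum_least (fun m => exists pi, rootward adj r pi /\
    m = \max_(i : 'I_#|T|) modified_cut adj r w pi i).
  by exists (\max_(i : 'I_#|T|) modified_cut adj r w pi0 i), pi0.
exists pi => // i; rewrite /directed_modified_cutwidth e.
exact: (@leq_bigmax _ (fun i => modified_cut adj r w pi i)).
Qed.

(** * Procedures that follow a given tree *)

Section FromTree.
Variables (R : realType) (N : tnetwork R).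

(** The root has a single child [c], so one tensor remains. Its index set is the load of the edge at
    the root, which is empty because no label sits there. *)
Lemma rooted_tree_exec (C : rooted_ctree N) :
  exists t s, contracts_in N t s /\ s <= tree_space C.
Proof.
rewrite /tree_space; have treeT := rct_tree C.
move: (rct_root C) (@rct_root_leaf _ C) (@rct_leafP _ C) => r root1 rootP.
have deg t : t != r -> degree (@rct_adj _ C) t \in [:: 1; 3].
  by move=> _; exact: rct_degree.
have leafP t : t != r -> (t \in codom (@rct_leaf _ C)) = (degree (@rct_adj _ C) t == 1).
  by move=> tr; rewrite rootP tr andbT.
have [par [dep [parP adjE _]]] := tree_parent treeT r.
have [pi Hpi cutM] := directed_modified_cutwidth_attained r
  (fun u v : rct_node C => 2 ^ rct_edgecon u v) treeT.
have [H [f [t [s [exH permH tagH _ [sM _]]]]]] :=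
  tree_exec treeT (@rct_leaf_inj _ C) deg leafP parP adjE Hpi cutM.
have rb : r \notin codom (@rct_leaf _ C) by rewrite rootP eqxx andbF.
have deg_r : degree (@rct_adj _ C) r = #|children r par r|.
  by apply: eq_card => v; rewrite !inE adjE eqxx.
have /esym/eqP/cards1P[c chE] := etrans (esym root1) deg_r.
have cc : c \in children r par r by rewrite chE set11.
have rc : rct_adj r c by rewrite adjE; move: cc; rewrite inE => ->; rewrite orbT.
have [L _] := leaf_load treeT (@rct_leaf_inj _ C) root1 rc.
exists t, s; split=> //; exists (f c).
  rewrite tagH // edge_loadC L; apply/setP => e; rewrite !inE.
  by apply: contraNF rb => /imsetP[v _ ->]; exact: codom_f.
have HE : H = [:: f c].
  by apply: perm_small_eq; rewrite // (perm_trans permH) // chE enum_set1.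
rewrite -HE; congr (exec _ _ _ _): exH; apply/setP => v; rewrite !inE.
by apply: contraNneq rb => <-; exact: codom_f.
Qed.

(** The tree is rooted at [x], which is processed last: a leaf is read, and an inner vertex
    contracts the tensors of its two neighbours other than [y]. The two tensors left belong to the
    two sides of the edge between [x] and [y], so they carry the same indices. *)
Lemma tree_exec_pair (C : ctree N) (x y : ct_node C) m : ct_adj x y ->
  (forall u v : ct_node C, ct_adj u v -> ct_edgecon u v <= m) ->
  exists A B t s, [/\ exec [set: vertex N] [:: A; B] t s,
    tag A = edge_load (@ct_adj _ C) (@ct_leaf _ C) x y, tag B = tag A,
    t = tree_time C
    & s <= #|ct_node C| * 2 ^ m /\ #|ct_node C| + 2 = 2 * #|vertex N|].
Proof.
move=> xy conm; have treeT := ct_tree C.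
have inj := @ct_leaf_inj _ C.
have [par [dep [parP adjE _]]] := tree_parent treeT x.
have [pi Hpi] := rootward_exists treeT x.
have powm (u v : ct_node C) : ct_adj u v -> 2 ^ ct_edgecon u v <= 2 ^ m.
  by move=> uv; rewrite leq_exp2l // conm.
(* Each vertex contributes at most the one edge above it, of weight at most [2 ^ m]. *)
have cutM i : modified_cut (@ct_adj _ C) x
    (fun u v => 2 ^ con_edge (@ct_adj _ C) (@ct_leaf _ C) u v) pi i <=
    #|ct_node C| * 2 ^ m.
  rewrite (modified_cut_par parP) -sum_nat_const big_mkcond /=.
  apply: leq_sum => u _; case: ifP => // /andP[ux _].
  by apply: powm; rewrite adjE ux eqxx.
have [H [f [t [s [exH permH tagH tE [sM cnt]]]]]] :=
  tree_exec treeT inj (fun u _ => ct_degree u)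
    (fun u _ => ct_leafP u) parP adjE Hpi cutM.
have chE v : (v \in children x par x) = ct_adj x v by rewrite adjE eqxx inE.
have deg_x : degree (@ct_adj _ C) x = #|children x par x|.
  by apply: eq_card => v; rewrite chE inE.
have T0 : 0 < #|ct_node C| by apply/card_gt0P; exists x.
have yc : y \in children x par x by rewrite chE.
have time_x : 2 ^ ct_con x + t = tree_time C.
  by rewrite /tree_time (bigD1 x) //= tE.
have := ct_degree x; rewrite !inE => /orP[]/eqP d.
- have /codomP[v xv] : x \in codom (@ct_leaf _ C) by rewrite ct_leafP d.
  have [L V] := leaf_load treeT inj d xy.
  have Lv : edge_load (@ct_adj _ C) (@ct_leaf _ C) x y = incident v.
    by rewrite L; apply/setP => e; rewrite !inE xv mem_imset.
  have [c cE] : exists c, children x par x = [set c] by apply/cards1P; rewrite -deg_x d.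
  have yE : y = c by apply/set1P; rewrite -cE.
  have HE : H = [:: f y].
    by apply: perm_small_eq; rewrite // (perm_trans permH) // cE enum_set1 yE.
  have DE : [set w | ct_leaf C w != x] = [set: vertex N] :\ v.
    by apply/setP => w; rewrite !inE andbT xv (inj_eq inj).
  have tg : tag (f y) = edge_load (@ct_adj _ C) (@ct_leaf _ C) x y.
    by rewrite tagH // edge_loadC.
  rewrite DE HE in exH cnt.
  have tg0 : tag (initial v) = edge_load (@ct_adj _ C) (@ct_leaf _ C) x y by rewrite Lv.
  have exv : exec [set: vertex N] [:: initial v; f y] (t + Defs.tsize (initial v))
      (maxn s (memory [:: initial v; f y])).
    rewrite -{1}(setD1K (finset.in_setT v)); apply: exec_read => //.
    by rewrite !inE eqxx.
  exists (initial v), (f y); eexists; eexists; split; first exact: exv.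
  + exact: tg0.
  + by rewrite tg tg0.
  + rewrite -time_x addnC; congr (_ + _).
    by rewrite /ct_con con_vertexE V Lv.
  (* After the reading two tensors of size at most [2 ^ m] are held. *)
  have T2 : 1 < #|ct_node C|.
    by rewrite (cardD1 x) (cardD1 y) !inE eq_sym (adj_neq treeT xy).
  split; last first.
    move: cnt T0; have := cardsD1 v [set: vertex N].
    by rewrite cardsT inE /=; clear; lia.
  rewrite geq_max sM !memory_cons /memory big_nil addn0 /Defs.tsize tg.
  rewrite tg0 addnn -mul2n -con_edgeE.
  exact: leq_mul T2 (powm _ _ xy).
have xb : x \notin codom (@ct_leaf _ C) by rewrite ct_leafP d.
have /esym := cardsD1 y (children x par x).
rewrite yc -deg_x d => -[].
move=> /eqP/cards2P[c1 [c2 [c12 cE]]].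
have cP c : (c == c1) || (c == c2) -> [/\ c != y, ct_adj x c & c \in children x par x].
  by rewrite -in_set2 -cE in_setD1 chE => /andP[].
have [c1y a1 c1c] : [/\ c1 != y, ct_adj x c1 & c1 \in children x par x].
  by apply: cP; rewrite eqxx.
have [c2y a2 c2c] : [/\ c2 != y, ct_adj x c2 & c2 \in children x par x].
  by apply: cP; rewrite eqxx orbT.
have u3 : uniq [:: c1; c2; y] by rewrite /= !inE negb_or c12 c1y c2y.
have [L V] := inner_load treeT xb d a1 a2 xy u3.
pose Z := contract (f c1) (f c2).
have permH3 : perm_eq H [:: f c1; f c2; f y].
  apply: perm_trans permH (perm_map f (_ : perm_eq _ [:: c1; c2; y])).
  apply: uniq_perm; rewrite ?enum_uniq // => w; rewrite mem_enum.
  by rewrite -(setD1K yc) cE !inE orbC -orbA.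
have DE : [set w | ct_leaf C w != x] = [set: vertex N].
  by apply/setP => w; rewrite !inE; apply: contraNneq xb => <-; exact: codom_f.
have tgc c : c \in children x par x ->
    tag (f c) = edge_load (@ct_adj _ C) (@ct_leaf _ C) x c.
  by move=> cc; rewrite tagH // edge_loadC.
have tgZ : tag Z = edge_load (@ct_adj _ C) (@ct_leaf _ C) x y.
  by rewrite tag_contract !tgc // L.
rewrite DE in exH cnt.
exists Z, (f y); eexists; eexists; split; first exact: exec_contract exH permH3.
- by [].
- by rewrite tgZ tgc.
- rewrite -time_x addnC; congr (_ + _).
  by rewrite /ct_con con_vertexE contraction_timeE V !tgc.
(* During this contraction four tensors are held, and the tree contains [x] and its three
   neighbours. *)
have T4 : 3 < #|ct_node C|.
  have u4 : uniq [:: x; c1; c2; y].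
    by rewrite cons_uniq u3 andbT !inE !negb_or !(adj_neq treeT).
  by have := max_card (mem [:: x; c1; c2; y]); rewrite (card_uniqP u4).
have sz3 : size H = 3 by rewrite (perm_size permH3).
split; last by move: cnt T0; rewrite sz3 cardsT; clear; lia.
rewrite geq_max sM memory_cons (memory_perm permH3) !memory_cons /memory big_nil.
rewrite addn0 /Defs.tsize tgZ !tgc // -!con_edgeE.
apply: leq_trans (leq_mul T4 (leqnn _)).
have := powm _ _ a1; have := powm _ _ a2; have := powm _ _ xy.
rewrite /ct_edgecon; clear; lia.
Qed.

Lemma tree_contracts (C : ctree N) (x y : ct_node C) m : ct_adj x y ->
  1 < #|vertex N| ->
  (forall u v : ct_node C, ct_adj u v -> ct_edgecon u v <= m) ->
  exists t s, [/\ contracts_in N t s, t = tree_time C + 2 ^ ct_edgecon x y,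
    s <= #|vertex N| * 2 ^ m.+1 & #|ct_node C| + 2 = 2 * #|vertex N|].
Proof.
move=> xy n2 conm.
have [A [B [t [s [ex tA tB tE [sM cnt]]]]]] := tree_exec_pair xy conm.
have tZ : tag (contract A B) = set0 by rewrite tag_contract tB setUid setDv.
eexists; eexists; split; first exists (contract A B); first exact: tZ.
- exact: exec_contract ex (perm_refl _).
- by rewrite tE contraction_timeE tB setUid tA -con_edgeE.
(* The run before the scalar product fits since the tree has at most twice as many vertices as [N].
   The scalar product itself holds one number and two tensors of size at most [2 ^ m], which is at
   most [4 * 2 ^ m]. *)
- rewrite geq_max (leq_trans sM) /=; last first.
    by rewrite expnS mulnA leq_mul // mulnC -cnt leq_addr.
  rewrite !memory_cons /memory big_nil addn0 /Defs.tsize tZ tB tA wsum0 -con_edgeE.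
  have p0 : 0 < 2 ^ m by rewrite expn_gt0.
  have := conm _ _ xy; rewrite -(@leq_exp2l 2) // -/(ct_edgecon x y) => le.
  apply: leq_trans (leq_mul n2 (leqnn _)); rewrite expnS; move: le p0; clear; lia.
- exact: cnt.
Qed.

End FromTree.

(** * From procedures to trees *)

Section History.
Variables (R : realType) (N : tnetwork R).

(* The operations of a procedure are numbered in the order in which they are
   performed; [par i] is the contraction that uses up the tensor [X i] produced
   by operation i, unless [X i] is still held, which is the case for i in [act].
   Operation [b v] reads the tensor of v, and operation i takes time [tau i]. *)
Record history (D : {set vertex N}) (H : seq (tensor R N)) (t s k : nat)
    (act : seq nat) (par : nat -> nat) (b : vertex N -> nat)
    (X : nat -> tensor R N) (tau : nat -> nat) : Prop := History {
  act_uniq : uniq act;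
  act_lt : forall i, i \in act -> i < k;
  par_lt : forall i, i < k -> i \notin act -> i < par i < k;
  leaf_op : forall v, v \in D ->
    [/\ b v < k, X (b v) = initial v & tau (b v) = Defs.tsize (initial v)];
  leaf_op_inj : {in D &, injective b};
  leaf_op_unused : forall v j, v \in D -> j < k -> j \notin act -> par j != b v;
  inner_op : forall i, i < k -> (forall v, v \in D -> b v != i) ->
    exists c1 c2, [/\ c1 != c2, c1 < k /\ c2 < k,
      forall j, (j < k) && (j \notin act) && (par j == i) = (j == c1) || (j == c2),
      X i = contract (X c1) (X c2) & tau i = contraction_time (X c1) (X c2)];
  held_perm : perm_eq H [seq X i | i <- act];
  time_sum : t = \sum_(i < k) tau i;
  memory_bound : forall i, i < k ->
    \sum_(j < k | (j <= i) && ((val j \in act) || (i <= par j))) Defs.tsize (X j) <= s;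
  op_count : k + size act = 2 * #|D|
}.

Definition has_history (D : {set vertex N}) H t s : Prop :=
  exists k act par b X tau, history D H t s k act par b X tau.

Lemma history_start : has_history set0 [::] 0 0.
Proof.
exists 0, [::], id, (fun _ => 0),
  (fun _ => Tagged (@entries R N) (0%R : entries R (set0 : {set edge N}))), id.
split=> //; try by [move=> v; rewrite inE | move=> v j; rewrite inE].
- by rewrite big_ord0.
- by rewrite cards0.
Qed.

Lemma sum_act (k : nat) (act : seq nat) (F : nat -> nat) : uniq act ->
  (forall i, i \in act -> i < k) ->
  \sum_(j < k | val j \in act) F j = \sum_(j <- act) F j.
Proof.
move=> ua lt; rewrite -(big_mkord (fun j => j \in act)) -[LHS]big_filter.
apply: perm_big; apply: uniq_perm; rewrite ?filter_uniq ?iota_uniq // => j.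
by rewrite mem_filter mem_index_iota; case: (boolP (j \in act)) => //= /lt ->.
Qed.

(** The reading becomes operation [k]. It uses up no earlier result, so [par] does not change. *)
Lemma history_read (D : {set vertex N}) H t s v : v \notin D ->
  has_history D H t s ->
  has_history (v |: D) (initial v :: H)
    (t + Defs.tsize (initial v)) (maxn s (memory (initial v :: H))).
Proof.
move=> vD [k [act [par [b [X [tau h]]]]]].
have kact : k \notin act by apply/negP => /(act_lt h); rewrite ltnn.
pose b' w := if w == v then k else b w.
pose X' (i : nat) := if i == k then initial v else X i.
pose tau' (i : nat) := if i == k then Defs.tsize (initial v) else tau i.
have b'D w : w \in D -> b' w = b w.
  by move=> wD; rewrite /b'; case: eqVneq wD vD => [->->|].
have X'k i : i < k -> X' i = X i by move=> lt; rewrite /X' ltn_eqF.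
have tau'k i : i < k -> tau' i = tau i by move=> lt; rewrite /tau' ltn_eqF.
have consumed i : (i < k.+1) && (i \notin k :: act) = (i < k) && (i \notin act).
  by rewrite inE negb_or ltnS leq_eqVlt; case: eqVneq => [->|] //=; rewrite ltnn.
have permH : perm_eq (initial v :: H) [seq X' i | i <- k :: act].
  rewrite /= {1}/X' eqxx perm_cons (perm_trans (held_perm h)) //.
  rewrite (_ : [seq X i | i <- act] = [seq X' i | i <- act]) //.
  by apply/eq_in_map => i /(act_lt h)/X'k.
exists k.+1, (k :: act), par, b', X', tau'; split=> //.
- by rewrite /= kact (act_uniq h).
- by move=> i; rewrite inE => /predU1P[->//|/(act_lt h)]; exact: leqW.
- move=> i lt ni; have /andP[lt' ni'] : (i < k) && (i \notin act) by rewrite -consumed lt.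
  by have /andP[-> /leqW ->] := par_lt h lt' ni'.
- move=> w; rewrite in_setU1 => /predU1P[->|wD].
    by rewrite /b' /X' /tau' !eqxx.
  have [lt eX et] := leaf_op h wD.
  by rewrite b'D // X'k // tau'k // leqW.
- move=> w1 w2; rewrite !in_setU1 => /predU1P[->|w1D] /predU1P[->|w2D] //.
  + rewrite (b'D _ w2D) /b' eqxx => e; have [] := leaf_op h w2D.
    by rewrite -e ltnn.
  + rewrite (b'D _ w1D) /b' eqxx => e; have [] := leaf_op h w1D.
    by rewrite e ltnn.
  + by rewrite !b'D //; exact: (leaf_op_inj h).
- move=> w j wD lt nj.
  have /andP[lt' nj'] : (j < k) && (j \notin act) by rewrite -consumed lt.
  move: wD; rewrite in_setU1 => /predU1P[->|wD].
    by rewrite /b' eqxx; have /andP[_ /ltn_eqF ->] := par_lt h lt' nj'.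
  by rewrite b'D //; exact: (leaf_op_unused h).
- move=> i; rewrite ltnS leq_eqVlt => /predU1P[-> /(_ v)|lt nb].
    by rewrite in_setU1 eqxx /b' eqxx => /(_ isT); rewrite eqxx.
  have [|c1 [c2 [c12 [l1 l2] cE XE tE]]] := inner_op h lt.
    by move=> w wD; rewrite -b'D // nb // in_setU1 wD orbT.
  exists c1, c2; split=> //; rewrite ?X'k ?tau'k //; first by split; exact: leqW.
  by move=> j; rewrite consumed.
- rewrite big_ord_recr /= {2}/tau' eqxx (time_sum h); congr (_ + _).
  by apply: eq_bigr => i _; rewrite tau'k.
(* At the new operation the sum of [memory_bound] runs over exactly the held tensors; at an earlier
   one the new tensor does not count yet. *)
- move=> i; rewrite ltnS leq_eqVlt => /predU1P[->|lt].
    apply: leq_trans (leq_maxr _ _).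
    rewrite (memory_perm permH) /memory big_map.
    rewrite -(sum_act (fun j => Defs.tsize (X' j)) (k := k.+1)); first last.
    + by move=> j; rewrite inE => /predU1P[->//|/(act_lt h)]; exact: leqW.
    + by rewrite /= kact (act_uniq h).
    rewrite eq_leq //; apply: eq_bigl => j; rewrite -ltnS ltn_ord /=.
    case: (boolP (val j \in _)) => //= nj.
    have /andP[lt nj'] : (j < k) && (val j \notin act) by rewrite -consumed ltn_ord.
    by have /andP[_] := par_lt h lt nj'; rewrite ltnNge => /negPf ->.
  apply: leq_trans (leq_maxl _ _); apply: leq_trans (memory_bound h lt).
  rewrite big_mkcond big_ord_recr /= [k <= i]leqNgt lt addn0 -big_mkcond.
  rewrite eq_leq //; apply: eq_big => j; first by rewrite inE ltn_eqF.
  by move=> _; rewrite X'k.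
- by rewrite /= addnS addSn (op_count h) cardsU1 vD mulnDr muln1 add2n.
Qed.

(** Several operations may have produced equal tensors, so one that produced a given held tensor is
    chosen here. *)
Lemma perm_map_cons (A B : eqType) (f : A -> B) y K (s : seq A) :
  perm_eq (y :: K) [seq f x | x <- s] ->
  exists x s', [/\ f x = y, perm_eq s (x :: s') & perm_eq K [seq f x | x <- s']].
Proof.
move=> p; have /mapP[x xs e] : y \in [seq f x | x <- s].
  by rewrite -(perm_mem p) mem_head.
exists x, (rem x s); split=> //; first exact: perm_to_rem.
by rewrite -(perm_cons y) (perm_trans p) // e (perm_map f (perm_to_rem xs)).
Qed.

(** Operations [p] and [q] produced the operands; the contraction becomes operation [k], their new
    parent. *)
Lemma history_contract D (H : seq (tensor R N)) t s A B K : perm_eq H [:: A, B & K] ->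
  has_history D H t s ->
  has_history D (contract A B :: K)
    (t + contraction_time A B) (maxn s (memory (contract A B :: H))).
Proof.
move=> permH [k [act [par [b [X [tau h]]]]]].
have p0 := perm_trans _ (held_perm h); move: permH; rewrite perm_sym => /p0.
move=> /perm_map_cons[p [act1 [eA pact1]]] /perm_map_cons[q [act2 [eB pact2 permK]]].
have pact : perm_eq act [:: p, q & act2].
  by apply: perm_trans pact1 _; rewrite perm_cons.
have actE i : (i \in act) = [|| i == p, i == q | i \in act2].
  by rewrite (perm_mem pact) !inE.
have : uniq [:: p, q & act2] by rewrite -(perm_uniq pact) (act_uniq h).
rewrite /= inE negb_or => /andP[/andP[pq pa2] /andP[qa2 ua2]].
have pk : p < k by apply: (act_lt h); rewrite actE eqxx.
have qk : q < k by apply: (act_lt h); rewrite actE eqxx orbT.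
have a2k i : i \in act2 -> i < k by move=> ia; apply: (act_lt h); rewrite actE ia !orbT.
have ka2 : k \notin act2 by apply/negP => /a2k; rewrite ltnn.
pose par' (i : nat) := if (i == p) || (i == q) then k else par i.
pose X' (i : nat) := if i == k then contract A B else X i.
pose tau' (i : nat) := if i == k then contraction_time A B else tau i.
have X'k i : i < k -> X' i = X i by move=> lt; rewrite /X' ltn_eqF.
have tau'k i : i < k -> tau' i = tau i by move=> lt; rewrite /tau' ltn_eqF.
have consumed i : (i < k.+1) && (i \notin k :: act2) =
    [|| i == p, i == q | (i < k) && (i \notin act)].
  rewrite inE negb_or actE !negb_or ltnS leq_eqVlt.
  case: (eqVneq i p) => [->|_] /=; first by rewrite pk pa2 ltn_eqF.
  case: (eqVneq i q) => [->|_] /=; first by rewrite qk qa2 ltn_eqF.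
  by case: (eqVneq i k) => [->|] //=; rewrite ltnn.
have par'N (i : nat) : i \notin act -> par' i = par i.
  by rewrite actE /par' => /norP[/negPf -> /norP[/negPf -> _]].
have permCK : perm_eq (contract A B :: K) [seq X' i | i <- k :: act2].
  rewrite /= {1}/X' eqxx perm_cons (perm_trans permK) //.
  rewrite (_ : [seq X i | i <- act2] = [seq X' i | i <- act2]) //.
  by apply/eq_in_map => i /a2k/X'k.
(* The operands still occupy memory while their contraction is formed, hence [k :: act] and not
   [k :: act2]. *)
have permCH : perm_eq (contract A B :: H) [seq X' i | i <- k :: act].
  rewrite /= {1}/X' eqxx perm_cons (perm_trans (held_perm h)) //.
  rewrite (_ : [seq X i | i <- act] = [seq X' i | i <- act]) //.
  by apply/eq_in_map => i /(act_lt h)/X'k.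
exists k.+1, (k :: act2), par', b, X', tau'; split=> //.
- by rewrite /= ka2.
- by move=> i; rewrite inE => /predU1P[->//|/a2k]; exact: leqW.
- move=> i lt ni; have := consumed i; rewrite lt ni /= /par'.
  case: (eqVneq i p) => [->|ip] /=; first by rewrite pk leqnn.
  case: (eqVneq i q) => [->|iq] /=; first by rewrite qk leqnn.
  move=> /esym/andP[lt' ni'].
  by have /andP[-> /leqW ->] := par_lt h lt' ni'.
- move=> w /(leaf_op h)[lt eX et].
  by rewrite X'k // tau'k // leqW.
- exact: (leaf_op_inj h).
- move=> w j wD lt nj; have := consumed j; rewrite lt nj /= /par'.
  have [bk _ _] := leaf_op h wD.
  case: (eqVneq j p) => [->|ip] /=; first by rewrite eq_sym ltn_eqF.
  case: (eqVneq j q) => [->|iq] /=; first by rewrite eq_sym ltn_eqF.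
  by move=> /esym/andP[lt' ni']; exact: (leaf_op_unused h).
- move=> i; rewrite ltnS leq_eqVlt => /predU1P[-> _|lt nb].
    exists p, q; split=> //.
    + by split; exact: leqW.
    + move=> j; rewrite consumed /par'.
      case: (eqVneq j p) => [->|ip] /=; first by rewrite eqxx.
      case: (eqVneq j q) => [->|iq] /=; first by rewrite eqxx.
      case: (boolP ((j < k) && (j \notin act))) => //= /andP[lt nj].
      by have /andP[_ /ltn_eqF ->] := par_lt h lt nj.
    + by rewrite {1}/X' eqxx !X'k // eA eB.
    + by rewrite {1}/tau' eqxx !X'k // eA eB.
  have [c1 [c2 [c12 [l1 l2] cE XE tE]]] := inner_op h lt nb.
  exists c1, c2; split=> //; rewrite ?X'k ?tau'k //; first by split; exact: leqW.
  move=> j; rewrite consumed -cE /par'.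
  case: (eqVneq j p) => [->|ip] /=; first by rewrite gtn_eqF // actE eqxx /= andbF.
  case: (eqVneq j q) => [->|iq] //=.
  by rewrite gtn_eqF // actE eqxx orbT /= andbF.
- rewrite big_ord_recr /= {2}/tau' eqxx (time_sum h); congr (_ + _).
  by apply: eq_bigr => i _; rewrite tau'k.
- move=> i; rewrite ltnS leq_eqVlt => /predU1P[->|lt].
    apply: leq_trans (leq_maxr _ _).
    rewrite (memory_perm permCH) /memory big_map.
    rewrite -(sum_act (fun j => Defs.tsize (X' j)) (k := k.+1)); first last.
    + by move=> j; rewrite inE => /predU1P[->//|/(act_lt h)]; exact: leqW.
    + rewrite /= (act_uniq h) andbT; apply/negP => /(act_lt h); by rewrite ltnn.
    rewrite eq_leq //; apply: eq_bigl => j; rewrite -ltnS ltn_ord /=.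
    rewrite !inE actE /par'.
    case: (eqVneq (val j) p) => [->|jp] /=; first by rewrite leqnn !orbT.
    case: (eqVneq (val j) q) => [->|jq] /=; first by rewrite leqnn !orbT.
    case: (eqVneq (val j) k) => //= jk; case: (boolP (_ \in act2)) => //= ja2.
    have lt : val j < k by have := ltn_ord j; rewrite ltnS leq_eqVlt (negPf jk).
    have nj : val j \notin act by rewrite actE !negb_or jp jq.
    by have /andP[_] := par_lt h lt nj; rewrite ltnNge => /negPf.
  apply: leq_trans (leq_maxl _ _); apply: leq_trans (memory_bound h lt).
  rewrite big_mkcond big_ord_recr /= [k <= i]leqNgt lt addn0 -big_mkcond.
  rewrite eq_leq //; apply: eq_big => j; last by move=> _; rewrite X'k.
  (* At earlier times [p] and [q] used to count as held; now they count because the operation using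
     them comes later. *)
  rewrite !inE ltn_eqF //= actE /par'.
  case: (eqVneq (val j) p) => [->|jp] /=; first by rewrite (ltnW lt) orbT.
  by case: (eqVneq (val j) q) => [->|jq] //=; rewrite (ltnW lt) orbT.
- have := op_count h; rewrite (perm_size pact) /=; lia.
Qed.

Lemma exec_history D H t s : exec D H t s -> has_history D H t s.
Proof.
elim=> [|{}D {}H {}t {}s v _ IH vD|{}D {}H {}t {}s A B K _ IH pH].
- exact: history_start.
- exact: history_read.
- exact: history_contract pH IH.
Qed.

End History.

(** * The tree of a recorded procedure *)

Section HistoryTree.
Variables (R : realType) (N : tnetwork R).
Variables (H : seq (tensor R N)) (t s k : nat) (act : seq nat) (par : nat -> nat).
Variables (b : vertex N -> nat) (X : nat -> tensor R N) (tau : nat -> nat) (M : nat).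
Hypothesis h : history [set: vertex N] H t s k act par b X tau.
Hypotheses (Mk : M <= k) (kM : k <= M.+1).

(* The root is the last operation when two tensors are left (M + 1 = k), and an
   additional node when only one is left (M = k). *)
Hypothesis act_root : M < k -> exists2 y, y != M & act =i [:: M; y].

(** Operations whose tensors are still held are attached to the root [M], which this encoding makes
    its own parent. *)
Definition node_parent (i : nat) : nat :=
  if (i < k) && (i \notin act) then par i else M.

Definition tree_parent_node (i : 'I_M.+1) : 'I_M.+1 := inord (node_parent i).

Definition history_adj : rel 'I_M.+1 := fun u v =>
  (u != ord_max) && (tree_parent_node u == v) ||
  (v != ord_max) && (tree_parent_node v == u).

Definition history_leaf (v : vertex N) : 'I_M.+1 := inord (b v).

Let adjE u v : history_adj u v =
  (u != ord_max) && (tree_parent_node u == v) ||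
  (v != ord_max) && (tree_parent_node v == u).
Proof. by []. Qed.

Lemma node_parent_le i : node_parent i <= M.
Proof.
rewrite /node_parent; case: ifP => // /andP[lt ni].
by have /andP[_ lt2] := par_lt h lt ni; rewrite -ltnS (leq_trans lt2).
Qed.

Lemma node_parentE (i : 'I_M.+1) : tree_parent_node i = node_parent i :> nat.
Proof. by rewrite inordK // ltnS node_parent_le. Qed.

Lemma neq_root (i : 'I_M.+1) : (i != ord_max) = (i < M).
Proof. by rewrite ltn_neqAle -ltnS ltn_ord andbT -val_eqE. Qed.

Lemma node_parent_lt (i : 'I_M.+1) : i != ord_max -> i < tree_parent_node i.
Proof.
rewrite neq_root node_parentE /node_parent => lt; case: ifP => // /andP[lt2 ni].
by have /andP[] := par_lt h lt2 ni.
Qed.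

Lemma history_tree : is_tree history_adj.
Proof. exact: (parent_tree adjE node_parent_lt). Qed.

Lemma history_toward u v :
  toward history_adj ord_max u v <-> u != ord_max /\ v = tree_parent_node u.
Proof. exact: (parent_toward adjE node_parent_lt). Qed.

Lemma history_leafE v : history_leaf v = b v :> nat.
Proof.
have [lt _ _] := leaf_op h (finset.in_setT v).
by rewrite inordK // (leq_trans lt).
Qed.

Lemma history_leaf_inj : injective history_leaf.
Proof.
move=> v w /(congr1 val) /=; rewrite !history_leafE.
by apply: (leaf_op_inj h); rewrite inE.
Qed.

Definition used_by (i j : nat) : bool := (j < k) && (j \notin act) && (par j == i).

Lemma used_lt i j : used_by i j -> j < i.
Proof. by case/andP=> /andP[lt nj] /eqP <-; have /andP[] := par_lt h lt nj. Qed.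

Lemma used_parent (i j : 'I_M.+1) : used_by i j -> tree_parent_node j = i.
Proof.
case/andP=> /andP[lt nj] /eqP e; apply: val_inj.
by rewrite /= node_parentE /node_parent lt nj.
Qed.

Lemma used_neq_root (i j : 'I_M.+1) : used_by i j -> j != ord_max.
Proof.
by move=> /used_lt lt; rewrite neq_root (leq_trans lt) // -ltnS ltn_ord.
Qed.

(** Besides the operations whose results it uses, an operation has exactly one neighbour [p]: its
    parent or, if it is itself the root, the other held operation. So degrees at the root follow the
    same rule as elsewhere. *)
Lemma history_neighbours (i : 'I_M.+1) : i < k -> exists p : 'I_M.+1,
  [/\ forall u, history_adj i u = (u == p) || used_by i u, ~~ used_by i p,
      i != ord_max -> p = tree_parent_node i & i = ord_max -> val p \in act].
Proof.
move=> ik; case: (eqVneq i ord_max) => [iM|ir].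
  have lt : M < k by rewrite iM in ik.
  have [y yM actE] := act_root lt.
  have ya : y \in act by rewrite actE !inE eqxx orbT.
  have yk : y < M.+1 by rewrite (leq_trans (act_lt h ya)).
  exists (inord y); rewrite iM; split=> // [u||_]; last 2 first.
  - by rewrite /used_by inordK // ya andbF.
  - by rewrite /= inordK.
  rewrite adjE eqxx /=.
  have uk : u < k by apply: leq_trans (ltn_ord u) _.
  rewrite -!val_eqE /= inordK // node_parentE /node_parent /used_by uk /= actE !inE.
  case: (eqVneq (val u) M) => [->|uM] /=; first by rewrite eq_sym (negPf yM).
  by case: (eqVneq (val u) y) => //= _; rewrite eqxx.
exists (tree_parent_node i); split=> // [u||/eqP]; last by rewrite (negPf ir).
  rewrite adjE ir /= eq_sym; congr orb; apply/idP/idP => [|uu].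
    case/andP=> _; rewrite -val_eqE /= node_parentE /node_parent /used_by.
    case: ifP => //= _ /eqP e; move: ir; rewrite neq_root -e.
    by rewrite ltnn.
  by rewrite (used_neq_root uu) (used_parent uu) eqxx.
apply/negP=> /used_lt; have := node_parent_lt ir; lia.
Qed.

Lemma leaf_node v : degree history_adj (history_leaf v) = 1 /\
  exists2 p, history_adj (history_leaf v) p &
    (history_leaf v != ord_max -> p = tree_parent_node (history_leaf v)).
Proof.
have [lt _ _] := leaf_op h (finset.in_setT v).
have [|p [E _ Ep _]] := @history_neighbours (history_leaf v); first by rewrite history_leafE.
have nu u : used_by (history_leaf v) u = false.
  apply/negP=> /andP[/andP[ltu nu]]; apply/negP; rewrite history_leafE.
  by apply: (leaf_op_unused h); rewrite ?inE.
split; last by exists p; rewrite // E eqxx.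
rewrite -(cards1 p); apply: eq_card => u.
by rewrite !inE E nu orbF.
Qed.

Lemma inner_node (i : 'I_M.+1) : i < k -> i \notin codom history_leaf ->
  exists c1 c2 p : 'I_M.+1, [/\ degree history_adj i = 3,
    [/\ uniq [:: c1; c2; p], history_adj i c1, history_adj i c2 & history_adj i p],
    used_by i c1 /\ used_by i c2, i != ord_max -> p = tree_parent_node i
    & X i = contract (X c1) (X c2) /\ tau i = contraction_time (X c1) (X c2)].
Proof.
move=> ik ni.
have [|c1 [c2 [c12 [l1 l2] cE XE tE]]] := inner_op h ik.
  move=> v _; apply: contra ni => /eqP e; apply/codomP; exists v.
  by apply: val_inj; rewrite /= history_leafE.
have [p [E np Ep _]] := history_neighbours ik.
have v1 : (inord c1 : 'I_M.+1) = c1 :> nat by rewrite inordK // (leq_trans l1).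
have v2 : (inord c2 : 'I_M.+1) = c2 :> nat by rewrite inordK // (leq_trans l2).
have u1 : used_by i (inord c1 : 'I_M.+1) by rewrite v1 /used_by cE eqxx.
have u2 : used_by i (inord c2 : 'I_M.+1) by rewrite v2 /used_by cE eqxx orbT.
have n12 : (inord c1 : 'I_M.+1) != inord c2 by rewrite -val_eqE /= v1 v2.
have n1p : (inord c1 : 'I_M.+1) != p by apply: contraTneq u1 => ->.
have n2p : (inord c2 : 'I_M.+1) != p by apply: contraTneq u2 => ->.
have u3 : uniq [:: inord c1 : 'I_M.+1; inord c2; p].
  by rewrite /= !inE negb_or n12 n1p n2p.
exists (inord c1), (inord c2), p; rewrite v1 v2; split=> //.
- rewrite -[3]/(size [:: inord c1 : 'I_M.+1; inord c2; p]) -(card_uniqP u3).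
  apply: eq_card => u; rewrite !inE E /used_by cE orbC -orbA.
  by rewrite -[u == inord c1]val_eqE -[u == inord c2]val_eqE /= v1 v2.
- by split=> //; rewrite E ?eqxx // ?u1 ?u2 orbT.
- by rewrite v1 v2 in u1 u2.
Qed.

Let load := edge_load history_adj history_leaf.

Lemma incidentE v : [set e | history_leaf v \in history_leaf @: ends e] = incident v.
Proof. by apply/setP => e; rewrite !inE mem_imset //; exact: history_leaf_inj. Qed.

(** Strong induction on the operation number, since a contraction uses results of smaller number;
    [leaf_load] treats readings and [inner_load] contractions. *)
Lemma node_tag (i : 'I_M.+1) : i != ord_max -> i < k ->
  tag (X i) = load i (tree_parent_node i).
Proof.
have [n] := ubnP (val i); elim: n i => // n IH i ltn ir ik.
case: (boolP (i \in codom history_leaf)) => [/codomP[v e]|ni].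
  have [d [p ip pE]] := leaf_node v.
  have [L _] := leaf_load history_tree history_leaf_inj d ip.
  have [_ XE _] := leaf_op h (finset.in_setT v).
  by rewrite e -pE -?e // /load e L incidentE history_leafE XE.
have [c1 [c2 [p [d [u3 a1 a2 ap] [u1 u2] pE [XE _]]]]] := inner_node ik ni.
have [L _] := inner_load history_tree ni d a1 a2 ap u3.
have tagc (c : 'I_M.+1) : used_by i c -> tag (X c) = load i c.
  move=> uc; have lt := used_lt uc.
  rewrite (IH c (leq_trans lt ltn) (used_neq_root uc) (ltn_trans lt ik)).
  by rewrite (used_parent uc); exact: edge_loadC.
by rewrite XE tag_contract !tagc // /load -L pE.
Qed.

(** This includes a root that is an operation: the load of a contraction vertex is already
    determined by the two edges to its operands, to which [node_tag] applies. *)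
Lemma node_time (i : 'I_M.+1) : i < k ->
  2 ^ con_vertex history_adj history_leaf i = tau i.
Proof.
move=> ik; rewrite con_vertexE.
case: (boolP (i \in codom history_leaf)) => [/codomP[v e]|ni].
  have [d [p ip _]] := leaf_node v.
  have [L V] := leaf_load history_tree history_leaf_inj d ip.
  have [_ _ tE] := leaf_op h (finset.in_setT v).
  by rewrite e V L incidentE history_leafE tE.
have [c1 [c2 [p [d [u3 a1 a2 ap] [u1 u2] _ [_ tE]]]]] := inner_node ik ni.
have [_ V] := inner_load history_tree ni d a1 a2 ap u3.
have tagc (c : 'I_M.+1) : used_by i c -> tag (X c) = load i c.
  move=> uc; rewrite node_tag ?(used_neq_root uc) //.
    by rewrite (used_parent uc); exact: edge_loadC.
  exact: ltn_trans (used_lt uc) ik.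
by rewrite tE contraction_timeE !tagc // V.
Qed.

Lemma degree_leaf (i : 'I_M.+1) : i < k ->
  degree history_adj i \in [:: 1; 3] /\
  (i \in codom history_leaf) = (degree history_adj i == 1).
Proof.
move=> ik; case: (boolP (i \in codom history_leaf)) => [/codomP[v ->]|ni].
  by have [-> _] := leaf_node v.
by have [c1 [c2 [p [-> _]]]] := inner_node ik ni.
Qed.

End HistoryTree.

(** * Trees of procedures that end with two tensors or with one *)

Section ToTree.
Variables (R : realType) (N : tnetwork R).

(** A result that is used up has a later user, and nothing comes after the last operation. *)
Lemma last_op_held D (H : seq (tensor R N)) t s k act par b X tau :
  history D H t s k act par b X tau -> 0 < size act -> 0 < k /\ k.-1 \in act.
Proof.
move=> h a0; have k0 : 0 < k.
  by case: act h a0 => // i act h _; apply: leq_ltn_trans (act_lt h (mem_head i act)).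
split=> //; apply: contraT => na.
have lt : k.-1 < k by rewrite prednK.
have /andP[l1 l2] := par_lt h lt na.
have : par k.-1 <= k.-1 by rewrite -ltnS prednK.
by rewrite leqNgt l1.
Qed.


(** The operations themselves are the vertices and the last one is the root; the chosen edge joins
    it to the other held operation [y]. The load of this edge is the index set of [A] or of [B],
    hence part of the union that gives the contraction time. *)
Lemma exec_pair_tree (A B : tensor R N) t s : exec [set: vertex N] [:: A; B] t s ->
  exists (C : ctree N) (x y : ct_node C), [/\ ct_adj x y, tree_time C = t &
    2 ^ ct_edgecon x y <= contraction_time A B].
Proof.
move=> /exec_history[k [act [par [b [X [tau h]]]]]].
have sz : size act = 2 by have := perm_size (held_perm h); rewrite size_map.
have [k0 ka] : 0 < k /\ k.-1 \in act by apply: (last_op_held h); rewrite sz.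
have kE : k = k.-1.+1 by rewrite prednK.
have [y yM actE] : exists2 y, y != k.-1 & act =i [:: k.-1; y].
  have pa := perm_to_rem ka.
  have : size (rem k.-1 act) = 1 by rewrite size_rem // sz.
  case er : (rem _ _) => [|y [|//]] // _; exists y.
    move: (act_uniq h); rewrite (perm_uniq pa) er /= inE.
    by rewrite eq_sym andbT.
  by move=> i; rewrite (perm_mem pa) er.
have ya : y \in act by rewrite actE !inE eqxx orbT.
have yk : y < k by exact: (act_lt h ya).
have kM : k <= k.-1.+1 by rewrite -kE.
have act_root : k.-1 < k -> exists2 y, y != k.-1 & act =i [:: k.-1; y].
  by exists y.
have ltk (i : 'I_k.-1.+1) : i < k by rewrite [X in _ < X]kE.
have leafP i := degree_leaf h (leq_pred k) kM act_root (ltk i).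
pose C := CTree (history_tree h kM)
  (fun i => (leafP i).1) (history_leaf_inj h kM) (fun i => (leafP i).2).
have yk' : y < k.-1.+1 by rewrite -kE.
have yr : (inord y : 'I_k.-1.+1) != ord_max by rewrite -val_eqE /= inordK.
have py : tree_parent_node k act par (inord y : 'I_k.-1.+1) = ord_max.
  apply: val_inj; rewrite /= (node_parentE h kM).
  by rewrite /node_parent inordK // ya andbF.
exists C, (inord y), ord_max; split.
- by rewrite /= /history_adj yr py eqxx.
- rewrite (time_sum h) [in RHS]kE; apply: eq_bigr => i _.
  exact: (node_time h (leq_pred k) kM act_root (ltk i)).
rewrite /ct_edgecon con_edgeE contraction_timeE leq_exp2l //.
have := node_tag h (leq_pred k) kM act_root yr (ltk _).
rewrite inordK // py => <-; apply: wsum_sub.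
have : X y \in [:: A; B] by rewrite (perm_mem (held_perm h)) map_f.
by rewrite !inE => /orP[]/eqP ->; rewrite ?subsetUl ?subsetUr.
Qed.

(** A node [k] is added above the last operation as unlabelled root. Node numbers are times, so the
    identity ordering bounds the cutwidth. *)
Lemma exec_rooted_tree (Z : tensor R N) t s : exec [set: vertex N] [:: Z] t s ->
  exists C : rooted_ctree N, tree_space C <= s.
Proof.
move=> /exec_history[k [act [par [b [X [tau h]]]]]].
have sz : size act = 1 by have := perm_size (held_perm h); rewrite size_map.
have [k0 ka] : 0 < k /\ k.-1 \in act by apply: (last_op_held h); rewrite sz.
have actE i : (i \in act) = (i == k.-1).
  by case: act sz ka {h} => [|j [|//]] // _; rewrite !inE => /eqP ->.
have act_root : k < k -> exists2 y, y != k & act =i [:: k; y] by rewrite ltnn.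
have leafP := degree_leaf h (leqnn k) (leqnSn k) act_root.
have rootN : (ord_max : 'I_k.+1) \notin codom (history_leaf b k).
  apply/negP=> /codomP[v /(congr1 val)] /=; rewrite (history_leafE h (leqnSn k)) => e.
  by have [] := leaf_op h (finset.in_setT v); rewrite -e ltnn.
have k1 : k.-1 < k.+1 by rewrite ltnS leq_pred.
have top_nroot : (inord k.-1 : 'I_k.+1) != ord_max.
  by rewrite -val_eqE /= inordK // ltn_eqF // prednK.
have parE (u : 'I_k.+1) : u != ord_max -> node_parent k act par k u =
    if val u == k.-1 then k else par u.
  rewrite /node_parent neq_root => ->; rewrite actE.
  by case: eqP.
have par_k (u : 'I_k.+1) : u != ord_max -> val u != k.-1 -> par u < k.
  rewrite neq_root => uk nu; have na : val u \notin act by rewrite actE.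
  by have /andP[] := par_lt h uk na.
have root1 : degree (history_adj k act par (M := k)) ord_max = 1.
  rewrite -(cards1 (inord k.-1 : 'I_k.+1)); apply: eq_card => u.
  rewrite !inE /history_adj eqxx /=; case: (eqVneq u ord_max) => [->|ur] /=.
    by rewrite eq_sym (negPf top_nroot).
  rewrite -[_ == ord_max]val_eqE -[_ == inord _]val_eqE /= inordK //.
  rewrite (node_parentE h (leqnSn k)) parE //.
  case: (eqVneq (val u) k.-1) => [_|un]; first by rewrite eqxx.
  exact: ltn_eqF (par_k u ur un).
have deg i : degree (history_adj k act par (M := k)) i \in [:: 1; 3].
  case: (eqVneq i ord_max) => [->|]; first by rewrite root1.
  by rewrite neq_root => /leafP[].
have leaf i : (i \in codom (history_leaf b k)) =
    (degree (history_adj k act par (M := k)) i == 1) && (i != ord_max).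
  case: (eqVneq i ord_max) => [->|]; first by rewrite andbF (negPf rootN).
  by rewrite andbT neq_root => /leafP[].
pose C := RootedCTree (history_tree h (leqnSn k)) deg root1
  (history_leaf_inj h (leqnSn k)) leaf.
exists C; have cT : k.+1 = #|'I_k.+1| by rewrite card_ord.
pose pi (i : 'I_k.+1) := cast_ord cT i.
have towP := history_toward h (leqnSn k).
have pir : rootward (rct_adj (r := C)) (rct_root C) pi.
  split=> [i j /cast_ord_inj //|u v /towP[ur ->]].
  exact: (node_parent_lt h (leqnSn k)).
(* The edge above [j] is counted at position [i] exactly when [memory_bound] counts the tensor [X j]
   during operation [i]. *)
have sum_le (i : nat) : i < k -> \sum_(u : 'I_k.+1 | (u != ord_max) &&
    (u <= i <= tree_parent_node k act par u))
    2 ^ rct_edgecon (u : rct_node C) (tree_parent_node k act par u) <= s.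
  move=> ik; apply: leq_trans (memory_bound h ik).
  rewrite big_mkcond big_ord_recr /= eqxx /= addn0 -big_mkcond /=.
  rewrite eq_leq //; apply: eq_big => [j|j _].
    rewrite neq_root (node_parentE h (leqnSn k)) /node_parent /= ltn_ord /=.
    by case: (boolP (val j \in act)) => //= _; rewrite (ltnW ik) andbT.
  have jr : widen_ord (leqnSn k) j != ord_max by rewrite neq_root /=.
  have := node_tag h (leqnn k) (leqnSn k) act_root jr (ltn_ord j).
  by rewrite /Defs.tsize /= => ->; rewrite /rct_edgecon con_edgeE.
rewrite /tree_space /directed_modified_cutwidth.
apply: leq_trans (minimum_le (ex_intro _ pi (conj pir erefl))) _.
apply/bigmax_leqP => i _; rewrite (modified_cut_par towP).
case: (ltnP i k) => ik; first exact: (sum_le i).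
(* Position [k] belongs to the root, which is no operation; every edge counted there is also counted
   at position [k.-1]. *)
apply: leq_trans (sum_le k.-1 _); last by rewrite prednK.
rewrite [X in X <= _]big_mkcond [X in _ <= X]big_mkcond; apply: leq_sum => u _.
case: ifP => // /and3P[ur _ iu]; rewrite ur; move: ur; rewrite neq_root => uk.
have -> : u <= k.-1 by rewrite -ltnS prednK.
by rewrite (leq_trans (leq_trans (leq_pred k) ik) iu).
Qed.

End ToTree.

(** * The bounds *)

Section Assembly.
Variables (R : realType) (N : tnetwork R).

Lemma exec_read_seq (l : seq (vertex N)) : uniq l -> exists t s,
  exec [set v | v \in l] [seq initial v | v <- l] t s.
Proof.
elim: l => [_|v l IH /= /andP[vl /IH[t [s ex]]]].
  exists 0, 0; rewrite (_ : [set v | v \in [::]] = set0); first exact: exec_start.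
  by apply/setP => v; rewrite !inE.
eexists; eexists; rewrite (_ : [set w | w \in v :: l] = v |: [set w | w \in l]).
  by apply: exec_read ex _; rewrite inE.
by apply/setP => w; rewrite !inE.
Qed.

Lemma exec_shrink D (H : seq (tensor R N)) t s : exec D H t s -> 1 < size H ->
  exists A B t' s', exec D [:: A; B] t' s'.
Proof.
have [m] := ubnP (size H); elim: m H t s => // m IH [|A [|B [|C K]]] // t s lt ex _.
  by exists A, B, t, s.
exact: IH _ (exec_contract ex (perm_refl _)) _.
Qed.

(** Reading everything and then contracting the first two tensors repeatedly is one such procedure.
    Its history also yields a contraction tree, which keeps the minima over trees from being
    junk. *)
Lemma reduces_to_pair_exists : 1 < #|vertex N| -> exists t s, reduces_to_pair_in N t s.
Proof.
move=> n2; have [t [s]] := exec_read_seq (enum_uniq (vertex N)).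
rewrite (_ : [set v | v \in enum (vertex N)] = [set: vertex N]); last first.
  by apply/setP => v; rewrite !inE mem_enum.
move=> /exec_shrink[|A [B [t' [s' ex]]]]; first by rewrite size_map -cardE.
by exists t', s', A, B.
Qed.

Lemma exec_nil D (H : seq (tensor R N)) t s : exec D H t s -> H = [::] -> D = set0.
Proof. by case. Qed.

(** A reading that leaves a single tensor would have to be the first operation, which is impossible
    with two or more vertices; so the last step is a contraction. *)
Lemma contracts_last t s : 1 < #|vertex N| -> contracts_in N t s ->
  exists A B t' s', exec [set: vertex N] [:: A; B] t' s' /\
    t = t' + contraction_time A B.
Proof.
move=> n2 [Z _]; move eD : [set: vertex N] => D; move eH : [:: Z] => H ex.
case: ex eD eH => [|D0 H0 t0 s0 v ex vD eD eH|D0 H0 t0 s0 A B K ex pH eD eH] //.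
  case: eH => _ /esym/(exec_nil ex) e; move: eD; rewrite e setU0 => eD.
  by move: n2; rewrite -cardsT eD cards1.
case: eH => _ eK; move: pH ex; rewrite -eK -eD => pH.
case: H0 pH (perm_size pH) => [|A' [|B' []]] // pH _ ex.
exists A', B', t0, s0; split=> //; congr (_ + _); rewrite !contraction_timeE.
(* The pair is known only up to order, but the contraction time depends only on the union of the two
   index sets. *)
have : \big[@setU (edge N)/set0]_(C <- [:: A'; B']) tag C =
    \big[@setU (edge N)/set0]_(C <- [:: A; B]) tag C.
  exact: perm_big.
by rewrite !big_cons !big_nil !setU0 => ->.
Qed.

Lemma tree_has_edge (C : ctree N) : 0 < #|vertex N| ->
  exists x y : ct_node C, ct_adj x y.
Proof.
move=> /card_gt0P[v _]; have : 0 < degree (@ct_adj _ C) (ct_leaf C v).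
  by have := ct_degree (ct_leaf C v); rewrite !inE => /orP[]/eqP ->.
by move=> /card_gt0P[y]; rewrite inE => xy; exists (ct_leaf C v), y.
Qed.

Lemma edgecon_le_vertex (C : ctree N) (x y : ct_node C) : ct_edgecon x y <= ct_con x.
Proof.
rewrite /ct_edgecon /ct_con con_edgeE con_vertexE; apply: wsum_sub.
exact: edge_load_vertex (ct_tree C) _ _.
Qed.

(** The factor 3/2 is cleared to stay within the natural numbers. At an inner vertex with edge loads
    [P], [Q] and their symmetric difference, each element of the union lies in exactly two of the
    three; at a leaf both congestions agree. *)
Lemma vertex_le_edgecon (C : ctree N) m (x : ct_node C) :
  (forall u v : ct_node C, ct_adj u v -> ct_edgecon u v <= m) ->
  2 * ct_con x <= 3 * m.
Proof.
move=> le; rewrite /ct_con con_vertexE.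
have leE y : ct_adj x y -> wsum (edge_load (@ct_adj _ C) (@ct_leaf _ C) x y) <= m.
  by move=> /le; rewrite /ct_edgecon con_edgeE.
have := ct_degree x; rewrite !inE => /orP[]/eqP d.
  have /card_gt0P[y] : 0 < degree (@ct_adj _ C) x by rewrite d.
  rewrite inE => xy; have [_ ->] := leaf_load (ct_tree C) (@ct_leaf_inj _ C) d xy.
  by have := leE _ xy; clear; lia.
have xb : x \notin codom (@ct_leaf _ C) by rewrite ct_leafP d.
have := enum_uniq [set u | ct_adj x u]; have := cardE [set u | ct_adj x u].
rewrite -/(degree _ x) d; case E : (enum _) => [|p [|q [|r []]]] // _ u3.
have N3 z : z \in [:: p; q; r] -> ct_adj x z by rewrite -E mem_enum inE.
have [xp xq xr] : [/\ ct_adj x p, ct_adj x q & ct_adj x r].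
  by split; apply: N3; rewrite !inE eqxx ?orbT.
have [L V] := inner_load (ct_tree C) xb d xp xq xr u3.
have := leE _ xp; have := leE _ xq; have := leE _ xr.
rewrite V L; move: (edge_load _ _ x p) (edge_load _ _ x q) => P Q.
rewrite wsum_symdiff wsumU (wsumID P Q) (wsumID Q P) [Q :&: P]setIC.
clear; lia.
Qed.

End Assembly.

(** The bound [P] is real so that it can be [2 ^ vertcon N] as well as a power with exponent
    [3 / 2 * edgecon N]. The vertices and the scalar product cost at most [#|ct_node C| + 1] times
    [P], and [#|ct_node C| + 2] is twice the number of vertices of [N]. *)
Lemma coarse_bounds (R : realType) (N : tnetwork R) (C : ctree N) m
    (P : R) : 1 < #|vertex N| ->
  (forall u v : ct_node C, ct_adj u v -> ct_edgecon u v <= m) ->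
  (forall u : ct_node C, (2 ^ ct_con u)%:R <= P)%R ->
  exists t s, [/\ contracts_in N t s, (t%:R <= #|vertex N|%:R * (2 * P))%R
    & s <= #|vertex N| * 2 ^ m.+1].
Proof.
move=> n2 conm conP; have [x [y xy]] := tree_has_edge C (ltnW n2).
have [t [s [ex tE sM cnt]]] := tree_contracts xy n2 conm.
exists t, s; split=> //.
have ecP : ((2 ^ ct_edgecon x y)%:R <= P)%R.
  apply: le_trans (conP x); rewrite ler_nat leq_exp2l //.
  exact: edgecon_le_vertex.
have P0 : (0 <= P)%R by apply: le_trans ecP; rewrite ler0n.
have ttP : ((tree_time C)%:R <= #|ct_node C|%:R * P)%R.
  rewrite /tree_time natr_sum mulr_natl -sumr_const; apply: ler_sum => u _; exact: conP.
rewrite tE natrD; apply: le_trans (lerD ttP ecP) _.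
have -> : (#|vertex N|%:R * (2 * P) = (#|ct_node C|%:R + 2) * P)%R.
  by rewrite mulrA [(_ * 2)%R]mulrC -natrM -cnt natrD.
by rewrite mulrDl lerD2l; lra.
Qed.

Theorem theorem1 (R : realType) (N : tnetwork R) (n : nat)
    (n_def : n = #|vertex N|) (n_ge2 : 1 < n) :
  (* coarse bounds *)
  (exists t s : nat, [/\ contracts_in N t s,
      t <= n * 2 ^ (vertcon N + 1) & s <= n * 2 ^ (vertcon N + 1)]) /\
  (exists t s : nat, [/\ contracts_in N t s,
      (t%:R <= n%:R * 2 `^ (3 / 2 * (edgecon N)%:R + 1) :> R)%R
      & s <= n * 2 ^ (edgecon N + 1)]) /\
  (* optimal time, without and with the final scalar product, which is taken
     over the indices routed through some edge of the tree *)
  least (fun t => exists s, reduces_to_pair_in N t s)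
    (minimum (fun m => exists C : ctree N, m = tree_time C)) /\
  least (fun t => exists s, contracts_in N t s)
    (minimum (fun m => exists (C : ctree N) (x y : ct_node C),
       ct_adj x y /\ m = tree_time C + 2 ^ ct_edgecon x y)) /\
  (* optimal space *)
  least (fun s => exists t, contracts_in N t s)
    (minimum (fun m => exists C : rooted_ctree N, m = tree_space C)).
Proof.
subst n; have n2 := n_ge2; have n0 := ltnW n2.
(* Any procedure provides a tree [C0], so none of the minima below is over an empty set. *)
have [t0 [s0 [A0 [B0 ex0]]]] := reduces_to_pair_exists n2.
have [C0 [x0 [y0 [xy0 _ _]]]] := exec_pair_tree ex0.
(* For the optimal times the space is irrelevant, so the total weight of [N] serves as the bound on
   edge congestion. *)
have conT (C : ctree N) (u v : ct_node C) : ct_adj u v -> ct_edgecon u v <= @wsum N setT.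
  by move=> _; rewrite /ct_edgecon con_edgeE wsum_sub ?subsetT.
split; [|split; [|split; [|split]]].
- have [|[C vE] _] := @minimum_least (fun m => exists C : ctree N,
      m = \max_(t : ct_node C) ct_con t).
    by exists (\max_(t : ct_node C0) ct_con t), C0.
  rewrite -/(vertcon N) in vE.
  have con_le (u : ct_node C) : ct_con u <= vertcon N.
    by rewrite vE; exact: (@leq_bigmax _ (fun u : ct_node C => ct_con u)).
  have [|u|t [s [ex tP sP]]] := @coarse_bounds R N C (vertcon N) ((2 ^ vertcon N)%:R)%R n2.
  + by move=> u v _; exact: leq_trans (edgecon_le_vertex _ _) (con_le u).
  + by rewrite ler_nat leq_exp2l.
  exists t, s; rewrite addn1; split=> //.
  by rewrite -(ler_nat R) natrM expnS natrM.
- have [|[C eE] _] := @minimum_least (fun m => exists C : ctree N,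
      m = \max_(f : ct_node C * ct_node C | ct_adj f.1 f.2) ct_edgecon f.1 f.2).
    by exists (\max_(f : ct_node C0 * ct_node C0 | ct_adj f.1 f.2)
      ct_edgecon f.1 f.2), C0.
  rewrite -/(edgecon N) in eE.
  have con_le (u v : ct_node C) : ct_adj u v -> ct_edgecon u v <= edgecon N.
    move=> uv; rewrite eE.
    exact: (@leq_bigmax_cond _ (fun f => ct_adj f.1 f.2)
      (fun f : ct_node C * ct_node C => ct_edgecon f.1 f.2) (u, v)).
  have [|t [s [ex tP sP]]] := @coarse_bounds R N C (edgecon N)
      (2 `^ (3 / 2 * (edgecon N)%:R))%R n2 con_le.
    move=> u; rewrite natrX -powR_mulrn ?ler0n // ler_powR ?ler1n //.
    have := vertex_le_edgecon u con_le; rewrite -(ler_nat R) !natrM; lra.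
  exists t, s; rewrite addn1; split=> //.
  by rewrite powRD ?pnatr_eq0 ?implybT // powRr1 ?ler0n // [(_ `^ _ * 2)%R]mulrC.
- apply: least_minimum.
  + by exists (tree_time C0), C0.
  + move=> m [C ->]; have [x [y xy]] := tree_has_edge C n0.
    have [A [B [t [s [ex _ _ <- _]]]]] := tree_exec_pair xy (conT C).
    by exists t => //; exists s, A, B.
  + move=> m [s [A [B /exec_pair_tree[C [x [y [_ tE _]]]]]]].
    by exists (tree_time C); [exists C | rewrite tE].
- apply: least_minimum.
  + by exists (tree_time C0 + 2 ^ ct_edgecon x0 y0), C0, x0, y0.
  + move=> m [C [x [y [xy ->]]]].
    have [t [s [ex <- _ _]]] := tree_contracts xy n2 (conT C).
    by exists t => //; exists s.
  (* Removing the last contraction leaves a procedure that ends with a pair; the scalar product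
     costs at least the term of the edge found by [exec_pair_tree]. *)
  + move=> t [s /(contracts_last n2)[A [B [t' [s' [ex ->]]]]]].
    have [C [x [y [xy <- le]]]] := exec_pair_tree ex.
    exists (tree_time C + 2 ^ ct_edgecon x y); last by rewrite leq_add2l.
    by exists C, x, y.
(* A full contraction along [C0] is turned back into a rooted tree [C1], so rooted trees exist
   too. *)
- have [t [s [[Z tZ exZ] _ _ _]]] := tree_contracts xy0 n2 (conT C0).
  have [C1 _] := exec_rooted_tree exZ.
  apply: least_minimum; first by exists (tree_space C1), C1.
  + move=> m [C ->]; have [t' [s' [ex le]]] := rooted_tree_exec C.
    by exists s' => //; exists t'.
  + move=> m [t' [Z' _ /exec_rooted_tree[C le]]].
    by exists (tree_space C) => //; exists C.
Qed.
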